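(* Let $N,D\ge 1$ be integers, $q>2$, $\delta>1$, $\eta_-,\eta_+\ge0$, $M\ge0$, and let $p$ be the conjugate exponent of $q$ ($\frac1p+\frac1q=1$). Then there is a constant $\theta>p$, depending only on $q,\delta,M,\eta_-,\eta_+,N$, and, for every $\rho>0$, a constant $C(\rho)>0$, depending only on $q,\delta,M,\eta_-,\eta_+,N$ and $\rho$, such that the following holds. Let $\mathcal{O}$ be a non-empty open subset of $\mathbb{R}^N_x\times\mathbb{R}_t$, let $H:\mathcal{O}\times\mathbb{R}^N\to\mathbb{R}$ be a continuous function satisfying $$\frac1\delta|z|^q-\eta_-\le H(x,t,z)\le\delta|z|^q+\eta_+\qquad\forall(x,t,z)\in\mathcal{O}\times\mathbb{R}^N,$$ let $a=\sigma\sigma^*$ where $\sigma:\mathcal{O}\to\mathbb{R}^{N\times D}$ is locally Lipschitz continuous and bounded by $\delta$ (i.e. $\|\sigma\|\le\delta$ in $\mathcal{O}$), and let $u$ be a continuous viscosity solution of $$u_t(x,t)-\mathrm{Tr}\left(a(x,t)D^2u(x,t)\right)+H(x,t,Du(x,t))=0\quad\text{in }\mathcal{O}$$ satisfying $|u|\le M$ in $\mathcal{O}$. Then, for every $\rho>0$, $$|u(x_1,t_1)-u(x_2,t_2)|\le C(\rho)\left\{|x_1-x_2|^{\frac{\theta-p}{\theta-1}}+|t_1-t_2|^{\frac{\theta-p}{\theta}}\right\}\qquad\forall(x_1,t_1),(x_2,t_2)\in\mathcal{O}_\rho .$$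
   Context: For $\rho>0$, $\mathcal{O}_\rho=\{(x,t)\in\mathcal{O}: d_{\mathcal{O}^c}(x,t)>\rho\}$, where $d_{\mathcal{O}^c}$ is the Euclidean distance function from the complement $\mathcal{O}^c$ of $\mathcal{O}$ in $\mathbb{R}^N\times\mathbb{R}$. $\mathbb{R}^{N\times D}$ is the space of real $N\times D$ matrices with norm $\|\sigma\|=\sqrt{\mathrm{Tr}(\sigma\sigma^* )}$, where $\sigma^*$ is the transpose of $\sigma$. $u_t=\partial u/\partial t$; $Du$ and $D^2u$ are the gradient and Hessian in $x$. The matrix $a$ may be degenerate, and $H$ is not assumed convex in $z$. *)

(* Defs.v *)
From mathcomp Require Import all_boot all_order all_algebra.
From mathcomp Require Import all_classical all_reals all_analysis.

Set Implicit Arguments.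
Unset Strict Implicit.
Unset Printing Implicit Defensive.

Import Order.TTheory GRing.Theory Num.Theory.
Import numFieldNormedType.Exports.

Local Open Scope classical_set_scope.
Local Open Scope ring_scope.

(* The library norm on matrices and on products is the sup norm; it induces the
   Euclidean topology, so `open`, `continuous`, `derivable` and local Lipschitz
   continuity below are the usual ones. Every norm whose actual value matters is
   written with one of the three definitions that follow. *)
Definition enorm (R : realType) (n : nat) (v : 'rV[R]_n) : R :=
  Num.sqrt (\sum_(i < n) v ord0 i ^+ 2).

Definition frobenius (R : realType) (m n : nat) (A : 'M[R]_(m, n)) : R :=
  Num.sqrt (\tr (A *m A^T)).

Definition stnorm (R : realType) (n : nat) (z : 'rV[R]_n * R) : R :=
  Num.sqrt (enorm z.1 ^+ 2 + z.2 ^+ 2).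

(* Extended-real valued: when O is the whole space its complement is empty, the
   distance is +oo, and `inner_set O rho` is O. *)
Definition dist_compl (R : realType) (n : nat) (O : set ('rV[R]_n * R))
    (z : 'rV[R]_n * R) : \bar R :=
  ereal_inf [set (stnorm (z - w))%:E | w in ~` O].

Definition inner_set (R : realType) (n : nat) (O : set ('rV[R]_n * R))
    (rho : R) : set ('rV[R]_n * R) :=
  [set z | O z /\ (rho%:E < dist_compl O z)%E].

Definition xdir (R : realType) (n : nat) (i : 'I_n) : 'rV[R]_n * R :=
  (delta_mx ord0 i, 0).

Definition tdir (R : realType) (n : nat) : 'rV[R]_n * R := (0, 1).

Definition dt (R : realType) (n : nat) (f : 'rV[R]_n * R -> R)
    (z : 'rV[R]_n * R) : R :=
  'D_(tdir R n) f z.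

Definition dx (R : realType) (n : nat) (i : 'I_n) (f : 'rV[R]_n * R -> R)
    (z : 'rV[R]_n * R) : R :=
  'D_(xdir R i) f z.

Definition grad_x (R : realType) (n : nat) (f : 'rV[R]_n * R -> R)
    (z : 'rV[R]_n * R) : 'rV[R]_n :=
  \row_i dx i f z.

Definition hess_x (R : realType) (n : nat) (f : 'rV[R]_n * R -> R)
    (z : 'rV[R]_n * R) : 'M[R]_n :=
  \matrix_(i, j) dx i (dx j f) z.

(* Class C^{2,1}(O): twice continuously differentiable in x, once in t. *)
Definition C21 (R : realType) (n : nat) (O : set ('rV[R]_n * R))
    (f : 'rV[R]_n * R -> R) : Prop :=
  [/\ forall z, O z ->
        [/\ derivable f z (tdir R n),
            forall i, derivable f z (xdir R i) &
            forall i j, derivable (dx j f) z (xdir R i)],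
      {within O, continuous f},
      {within O, continuous (dt f)},
      forall i, {within O, continuous (dx i f)} &
      forall i j, {within O, continuous (dx i (dx j f))}].

(* O is meant to be open, so `\near z` may be read inside O. Only the values on
   O (resp. O x R^n) of a, H, u and of the test functions matter. *)
Definition continuous_viscosity_solution (R : realType) (n : nat)
    (O : set ('rV[R]_n * R)) (a : 'rV[R]_n * R -> 'M[R]_n)
    (H : 'rV[R]_n * R -> 'rV[R]_n -> R) (u : 'rV[R]_n * R -> R) : Prop :=
  [/\ {within O, continuous u},
      forall phi, C21 O phi -> forall z, O z ->
        (\forall w \near z, u w - phi w <= u z - phi z) ->
        dt phi z - \tr (a z *m hess_x phi z) + H z (grad_x phi z) <= 0 &
      forall phi, C21 O phi -> forall z, O z ->
        (\forall w \near z, u z - phi z <= u w - phi w) ->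
        0 <= dt phi z - \tr (a z *m hess_x phi z) + H z (grad_x phi z)].

Definition locally_lipschitz_on (R : realType) (V W : normedModType R)
    (O : set V) (f : V -> W) : Prop :=
  forall z, O z -> exists2 U, nbhs z U & [lipschitz f w | w in U `&` O].

(* Main.v *)
Require Import Defs.
From mathcomp Require Import all_boot all_order all_algebra.
From mathcomp Require Import all_classical all_reals all_analysis.
From mathcomp Require Import ring lra.

Set Implicit Arguments.
Unset Strict Implicit.
Unset Printing Implicit Defensive.

Import Order.TTheory GRing.Theory Num.Theory.
Import numFieldNormedType.Exports.

Local Open Scope classical_set_scope.
Local Open Scope ring_scope.

(** The equation is of first order at small scales. If space is shrunk by [lam],
    values by [K] and time by [mu], with [mu] chosen so that the time derivative
    and the power [q] of the gradient scale alike, the diffusion is multiplied by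
    [mu / lam ^ 2] and the bounded error in the growth condition by [mu / K]
    ([quad_solution_rescale]). Since [q > 2], both stay small along a sequence of
    shrinking boxes as long as the values do not shrink faster than
    [lam ^ ((q - 2) / (q - 1))]. It is therefore enough to gain a fixed fraction of
    the oscillation from one box to a smaller one, uniformly over solutions with
    small diffusion and small error ([oscillation_decay_step]); iterating gives a
    geometric decay ([geometric_decay]), that is a Hoelder estimate
    ([hoelder_of_decay], [inner_hoelder]), and [theta] is defined from the exponent
    obtained.

    Normalize [0 <= u <= 1] on the unit box and look at a time slightly before the
    centre. If [u <= 1/2] at one point of that time slice near the centre, then a
    strict supersolution built on
    [C |x - y0|^2 t^(- p / 2) + kap t^(1 - p / 2)] shows that [u <= 7/8]
    around the centre ([forward_spreading]): where the first term is large its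
    gradient term beats its time derivative because [q > 2], and where it is small
    the growth of the second term pays; both pieces have the same homogeneity
    precisely for the exponent [p / 2]. If on the contrary [u > 1/2] on the whole
    slice near the centre, a paraboloid decreasing slowly in time is a strict
    subsolution and keeps [u] away from zero around the centre
    ([high_value_persists]).

    Every test function used is [A t + E t * |x - y|^2]. On these the equation is
    only felt through the trace of the diffusion matrix and the growth of the
    Hamiltonian. This is recorded in the class [quad_solution], which involves
    the solution only through the bounds on that trace and on the error and is
    therefore stable under scaling. *)

(** * Quadratic test functions *)

Definition sqnorm (R : realType) (n : nat) (d : 'rV[R]_n) : R :=
  \sum_(i < n) d ord0 i ^+ 2.

Definition quad (R : realType) (n : nat) (A E : R -> R) (y : 'rV[R]_n)
    (z : 'rV[R]_n * R) : R :=
  A z.2 + E z.2 * sqnorm (z.1 - y).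

(** The derivative is carried along explicitly, since the barriers are used
    through formulas for their derivatives. *)
Definition C1_with (R : realType) (A A' : R -> R) : Prop :=
  (forall t : R, is_derive t 1 A (A' t)) /\ continuous A'.

Lemma C1_with_continuous (R : realType) (A A' : R -> R) :
  C1_with A A' -> continuous A.
Proof.
case=> dA _ t; apply/differentiable_continuous/derivable1_diffP.
by case: (dA t).
Qed.

Lemma sqnorm_ge0 (R : realType) (n : nat) (d : 'rV[R]_n) : 0 <= sqnorm d.
Proof. by apply: sumr_ge0 => i _; exact: sqr_ge0. Qed.

Lemma sqnorm_line (R : realType) (n : nat) (i : 'I_n) (h : R) (d : 'rV[R]_n) :
  sqnorm (h *: delta_mx ord0 i + d) = sqnorm d + h * (2 * d ord0 i) + h ^+ 2.
Proof.
rewrite /sqnorm (bigD1 i) //= [in RHS](bigD1 i) //= !mxE !eqxx /=.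
rewrite (eq_bigr (fun j => d ord0 j ^+ 2)); last first.
  by move=> j nji; rewrite !mxE eqxx (negbTE nji) /= mulr0 add0r.
by ring.
Qed.

Lemma continuous_sqnorm (R : realType) (n : nat) :
  continuous (@sqnorm R n).
Proof.
apply: continuous_big => [|i _ d]; first exact: add_continuous.
apply: (@continuous_comp _ _ _ (fun d : 'rV[R]_n => d ord0 i) (fun r => r ^+ 2)).
  exact: coord_continuous.
exact: exprn_continuous.
Qed.

(** A directional derivative only sees the restriction to a line; this reduces
    every derivative of a test function to a one-variable computation. *)
Lemma is_derive_along (R : realType) (V : normedModType R) (f : V -> R)
    (z v : V) (g : R -> R) (c l : R) :
  (forall h, f (h *: v + z) = g (h + c)) -> is_derive c 1 g l ->
  is_derive z v f l.
Proof.
move=> fg [dg vg].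
have E : (fun h => h^-1 *: ((f \o shift z) (h *: v) - f z)) =
         (fun h => h^-1 *: ((g \o shift c) (h *: 1) - g c)).
  apply/funext => h /=; rewrite fg.
  have -> : f z = g c by have := fg 0; rewrite scale0r !add0r.
  by rewrite [h *: 1]mulr1.
by split; [rewrite /derivable E | rewrite /derive E].
Qed.

Section quad_calculus.
Variables (R : realType) (n : nat) (A A' E E' : R -> R) (y : 'rV[R]_n).
Hypotheses (hA : C1_with A A') (hE : C1_with E E').

Lemma is_derive_quad_t (z : 'rV[R]_n * R) :
  is_derive z (tdir R n) (quad A E y) (quad A' E' y z).
Proof.
apply: (@is_derive_along _ _ _ _ _
  (fun t => A t + E t * sqnorm (z.1 - y)) z.2).
  by move=> h; rewrite /quad /= scaler0 add0r [h *: 1]mulr1.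
have dA := hA.1 z.2; have dE := hE.1 z.2.
rewrite /quad (_ : E' z.2 * _ = sqnorm (z.1 - y) *: E' z.2); last exact: mulrC.
rewrite (_ : (fun t => _) = A + sqnorm (z.1 - y) *: E); last first.
  by apply/funext => t /=; rewrite [in LHS]mulrC.
exact: is_deriveD.
Qed.

Lemma is_derive_quad_x (i : 'I_n) (z : 'rV[R]_n * R) :
  is_derive z (xdir R i) (quad A E y) (2 * E z.2 * (z.1 - y) ord0 i).
Proof.
set c := (z.1 - y) ord0 i.
apply: (@is_derive_along _ _ _ _ _
  (fun h => quad A E y z + E z.2 * (h * (2 * c) + h ^+ 2)) 0).
  move=> h; rewrite /quad /= scaler0 add0r addr0 -addrA sqnorm_line -/c.
  by ring.
apply: is_derive_eq.
by rewrite /GRing.scale /=; ring.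
Qed.

Lemma dt_quad : dt (quad A E y) = quad A' E' y.
Proof. by apply/funext => z; case: (is_derive_quad_t z). Qed.

Lemma dx_quad (i : 'I_n) :
  dx i (quad A E y) = fun z => 2 * E z.2 * (z.1 - y) ord0 i.
Proof. by apply/funext => z; case: (is_derive_quad_x i z). Qed.

Lemma is_derive_dx_quad (i j : 'I_n) (z : 'rV[R]_n * R) :
  is_derive z (xdir R i) (dx j (quad A E y)) (2 * E z.2 * (i == j)%:R).
Proof.
rewrite dx_quad.
apply: (@is_derive_along _ _ _ _ _
  (fun h => 2 * E z.2 * ((i == j)%:R * h + (z.1 - y) ord0 j)) 0).
  by move=> h; rewrite /= scaler0 add0r addr0 !mxE eqxx /= eq_sym; ring.
apply: is_derive_eq.
by rewrite /GRing.scale /=; ring.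
Qed.

Lemma dxx_quad (i j : 'I_n) :
  dx i (dx j (quad A E y)) = fun z => 2 * E z.2 * (i == j)%:R.
Proof. by apply/funext => z; case: (is_derive_dx_quad i j z). Qed.

Lemma grad_quad (z : 'rV[R]_n * R) :
  grad_x (quad A E y) z = (2 * E z.2) *: (z.1 - y).
Proof. by apply/rowP => i; rewrite mxE dx_quad !mxE. Qed.

Lemma hess_quad (z : 'rV[R]_n * R) :
  hess_x (quad A E y) z = (2 * E z.2)%:M.
Proof.
by apply/matrixP => i j; rewrite !mxE dxx_quad mulr_natr.
Qed.

Lemma continuous_quad_of (B F : R -> R) :
  continuous B -> continuous F -> continuous (quad B F y).
Proof.
move=> cB cF z.
have c1 : (fst w) @[w --> z] --> z.1 by exact: cvg_fst.
have c2 : (snd w) @[w --> z] --> z.2 by exact: cvg_snd.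
apply: cvgD; first exact: (cvg_comp _ _ c2 (cB _)).
apply: cvgM; first exact: (cvg_comp _ _ c2 (cF _)).
have c3 : w.1 - y @[w --> z] --> z.1 - y by apply: cvgB => //; exact: cvg_cst.
exact: (cvg_comp _ _ c3 (@continuous_sqnorm _ _ _)).
Qed.

Lemma continuous_quad : continuous (quad A E y).
Proof.
exact: continuous_quad_of (C1_with_continuous hA) (C1_with_continuous hE).
Qed.

Lemma C21_quad (O : set ('rV[R]_n * R)) : C21 O (quad A E y).
Proof.
have cE := C1_with_continuous hE.
have c1 (z : 'rV[R]_n * R) : (fst w) @[w --> z] --> z.1 by exact: cvg_fst.
have c2 (z : 'rV[R]_n * R) : (snd w) @[w --> z] --> z.2 by exact: cvg_snd.
have c2E (z : 'rV[R]_n * R) : 2 * E w.2 @[w --> z] --> 2 * E z.2.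
  exact: (cvgM (cvg_cst _) (cvg_comp _ _ (c2 z) (cE _))).
split.
- move=> z _; split=> [|i|i j].
  + by case: (is_derive_quad_t z).
  + by case: (is_derive_quad_x i z).
  + by case: (is_derive_dx_quad i j z).
- exact/continuous_subspaceT/continuous_quad.
- rewrite dt_quad; apply/continuous_subspaceT/continuous_quad_of.
    exact: hA.2.
  exact: hE.2.
- move=> i; rewrite dx_quad; apply: continuous_subspaceT => z.
  apply: cvgM; first exact: c2E.
  have c3 : w.1 - y @[w --> z] --> z.1 - y.
    exact: (cvgB (c1 z) (cvg_cst _)).
  exact: (cvg_comp _ _ c3 (@coord_continuous _ _ _ _ _ _)).
- move=> i j; rewrite dxx_quad; apply: continuous_subspaceT => z.
  exact: (cvgM (c2E z) (cvg_cst _)).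
Qed.

End quad_calculus.

(** * Touching the solution by quadratic test functions *)

(** What remains of the equation on a quadratic test function once the trace of
    the diffusion matrix is replaced by the bound [nu] and the Hamiltonian by
    [c] times the power [q] of the gradient. *)
Definition quadop (R : realType) (n : nat) (q c nu : R) (A' E' E : R -> R)
    (y : 'rV[R]_n) (z : 'rV[R]_n * R) : R :=
  quad A' E' y z - 2 * E z.2 * nu
  + c * (2 * `|E z.2|) `^ q * sqnorm (z.1 - y) `^ (q / 2).

Definition quad_sub (R : realType) (n : nat) (q delta nu eta : R)
    (O : set ('rV[R]_n * R)) (u : 'rV[R]_n * R -> R) : Prop :=
  forall (A A' E E' : R -> R) (y : 'rV[R]_n) (z : 'rV[R]_n * R),
    C1_with A A' -> C1_with E E' -> O z -> 0 <= E z.2 ->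
    (\forall w \near z, u w - quad A E y w <= u z - quad A E y z) ->
    quadop q delta^-1 nu A' E' E y z <= eta.

Definition quad_super (R : realType) (n : nat) (q delta nu eta : R)
    (O : set ('rV[R]_n * R)) (u : 'rV[R]_n * R -> R) : Prop :=
  forall (A A' E E' : R -> R) (y : 'rV[R]_n) (z : 'rV[R]_n * R),
    C1_with A A' -> C1_with E E' -> O z -> E z.2 <= 0 ->
    (\forall w \near z, u z - quad A E y z <= u w - quad A E y w) ->
    - eta <= quadop q delta nu A' E' E y z.

Definition quad_solution (R : realType) (n : nat) (q delta nu eta : R)
    (O : set ('rV[R]_n * R)) (u : 'rV[R]_n * R -> R) : Prop :=
  [/\ forall z, O z -> {for z, continuous u},
      quad_sub q delta nu eta O u & quad_super q delta nu eta O u].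

Lemma enormE (R : realType) (n : nat) (d : 'rV[R]_n) :
  enorm d = Num.sqrt (sqnorm d).
Proof. by []. Qed.

Lemma sqnormZ (R : realType) (n : nat) (c : R) (d : 'rV[R]_n) :
  sqnorm (c *: d) = c ^+ 2 * sqnorm d.
Proof.
rewrite /sqnorm mulr_sumr; apply: eq_bigr => i _.
by rewrite mxE exprMn.
Qed.

Lemma enorm_powR (R : realType) (n : nat) (q c : R) (d : 'rV[R]_n) :
  enorm (c *: d) `^ q = `|c| `^ q * sqnorm d `^ (q / 2).
Proof.
rewrite enormE sqnormZ sqrtrM ?sqr_ge0// sqrtr_sqr powRM ?sqrtr_ge0//.
congr (_ * _); rewrite -powR12_sqrt ?sqnorm_ge0// -powRrM; congr (_ `^ _).
by field.
Qed.

Lemma trace_diffusion (R : realType) (m n : nat) (A : 'M[R]_(m, n)) (delta : R) :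
  0 <= delta -> frobenius A <= delta -> 0 <= \tr (A *m A^T) <= delta ^+ 2.
Proof.
move=> d0 hA.
have t0 : 0 <= \tr (A *m A^T).
  apply: sumr_ge0 => i _; rewrite mxE; apply: sumr_ge0 => j _.
  by rewrite !mxE -expr2 sqr_ge0.
rewrite t0 -(sqr_sqrtr t0) ler_sqr ?nnegrE ?sqrtr_ge0//.
Qed.

(** The Hessian of a quadratic test function is scalar, so the diffusion only
    enters through its trace, which lies between zero and [delta ^+ 2]; with the
    sign of [E] prescribed, replacing the trace by its upper bound goes in the
    right direction. *)
Lemma viscosity_quad_solution (R : realType) (n D : nat)
    (q delta eta_m eta_p eta : R) (O : set ('rV[R]_n * R))
    (H : 'rV[R]_n * R -> 'rV[R]_n -> R)
    (sigma : 'rV[R]_n * R -> 'M[R]_(n, D)) (u : 'rV[R]_n * R -> R) :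
  0 < delta -> eta_m <= eta -> eta_p <= eta -> open O ->
  (forall (y : 'rV[R]_n * R) (z : 'rV[R]_n), O y ->
     delta^-1 * enorm z `^ q - eta_m <= H y z <= delta * enorm z `^ q + eta_p) ->
  (forall y, O y -> frobenius (sigma y) <= delta) ->
  continuous_viscosity_solution O (fun y => sigma y *m (sigma y)^T) H u ->
  quad_solution q delta (delta ^+ 2) eta O u.
Proof.
move=> d0 em ep oO hH hs [cu hsub hsup]; split.
- move=> z Oz; move: cu; rewrite continuous_open_subspace // => cu.
  by apply: cu; exact: mem_set.
- move=> A A' E E' y z hA hE Oz E0 hmax.
  have := hsub _ (C21_quad y hA hE O) z Oz hmax.
  rewrite (dt_quad _ hA hE) hess_quad grad_quad.
  rewrite mul_mx_scalar linearZ /=.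
  have /andP[+ _] := hH z ((2 * E z.2) *: (z.1 - y)) Oz.
  have /andP[t0 t1] := trace_diffusion (ltW d0) (hs z Oz).
  rewrite enorm_powR normrM (ger0_norm (ler0n _ 2)) /quadop mulrA.
  move: t0 t1; set T := \tr _ => t0 t1.
  have : E z.2 * T <= E z.2 * delta ^+ 2 by exact: ler_wpM2l.
  by rewrite /GRing.scale /=; lra.
- move=> A A' E E' y z hA hE Oz E0 hmin.
  have := hsup _ (C21_quad y hA hE O) z Oz hmin.
  rewrite (dt_quad _ hA hE) hess_quad grad_quad.
  rewrite mul_mx_scalar linearZ /=.
  have /andP[_] := hH z ((2 * E z.2) *: (z.1 - y)) Oz.
  have /andP[t0 t1] := trace_diffusion (ltW d0) (hs z Oz).
  rewrite enorm_powR normrM (ger0_norm (ler0n _ 2)) /quadop mulrA.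
  move: t0 t1; set T := \tr _ => t0 t1.
  have : E z.2 * delta ^+ 2 <= E z.2 * T by exact: ler_wnM2l.
  by rewrite /GRing.scale /=; lra.
Qed.

(** * Scaling *)

Definition rescale (R : realType) (n : nat) (lam mu : R) (z0 : 'rV[R]_n * R)
    (w : 'rV[R]_n * R) : 'rV[R]_n * R :=
  (z0.1 + lam *: w.1, z0.2 + mu * w.2).

Lemma continuous_rescale (R : realType) (n : nat) (lam mu : R)
    (z0 : 'rV[R]_n * R) : continuous (rescale lam mu z0).
Proof.
move=> w.
have c1 : (fst v) @[v --> w] --> w.1 by exact: cvg_fst.
have c2 : (snd v) @[v --> w] --> w.2 by exact: cvg_snd.
have c3 : z0.1 + lam *: v.1 @[v --> w] --> z0.1 + lam *: w.1.
  exact: (cvgD (cvg_cst _) (cvgZl_tmp c1)).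
have c4 : z0.2 + mu * v.2 @[v --> w] --> z0.2 + mu * w.2.
  exact: (cvgD (cvg_cst _) (cvgMl_tmp c2)).
exact: (cvg_pair c3 c4).
Qed.

Lemma C1_with_affine (R : realType) (A A' : R -> R) (m k mu t0 : R) :
  C1_with A A' ->
  C1_with (fun t => m + k * A ((t - t0) / mu))
          (fun t => k / mu * A' ((t - t0) / mu)).
Proof.
move=> [dA cA]; split.
  move=> t.
  have dA1 := dA ((t - t0) / mu).
  have dl : is_derive t 1 (fun t : R => (t - t0) / mu) (mu^-1).
    apply: is_derive_eq; by rewrite /GRing.scale /=; ring.
  have dc := @is_derive1_comp _ A (fun t : R => (t - t0) / mu) _ _ _ dA1 dl.
  have dk := is_deriveD (is_derive_cst m t 1) (is_deriveZ k dc).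
  have -> : (fun t => m + k * A ((t - t0) / mu)) =
      cst m + k *: (A \o (fun t : R => (t - t0) / mu)) by apply/funext.
  apply: (is_derive_eq dk).
  by rewrite /GRing.scale /= add0r mulrAC mulrA.
move=> t; apply: cvgMl_tmp.
have c1 : (s - t0) / mu @[s --> t] --> (t - t0) / mu.
  exact: (cvgMr_tmp (cvgB cvg_id (cvg_cst _))).
exact: (cvg_comp _ _ c1 (cA _)).
Qed.

Section scaling.
Variables (R : realType) (n : nat) (q : R) (lam mu K m : R) (z0 : 'rV[R]_n * R).
Hypotheses (lam0 : 0 < lam) (mu0 : 0 < mu) (K0 : 0 < K) (q0 : 0 < q).
(* The time derivative and the power of the gradient scale by the same factor. *)
Hypothesis balance : (K / lam) `^ q = K / mu.

Lemma quad_rescale (A E : R -> R) (y : 'rV[R]_n) (w : 'rV[R]_n * R) (c k : R) :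
  quad (fun t => c + k * A ((t - z0.2) / mu))
    (fun t => 0 + k / lam ^+ 2 * E ((t - z0.2) / mu))
    (z0.1 + lam *: y) (rescale lam mu z0 w) = c + k * quad A E y w.
Proof.
rewrite /quad /rescale /=.
have -> : (z0.2 + mu * w.2 - z0.2) / mu = w.2 by field; rewrite gt_eqF.
have -> : z0.1 + lam *: w.1 - (z0.1 + lam *: y) = lam *: (w.1 - y).
  by rewrite scalerBr opprD addrACA subrr add0r.
by rewrite sqnormZ; field; rewrite gt_eqF.
Qed.

Lemma quadop_rescale (A' E' E : R -> R) (y : 'rV[R]_n) (w : 'rV[R]_n * R)
    (c nu : R) :
  quadop q c nu (fun t => K / mu * A' ((t - z0.2) / mu))
    (fun t => K / lam ^+ 2 / mu * E' ((t - z0.2) / mu))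
    (fun t => 0 + K / lam ^+ 2 * E ((t - z0.2) / mu))
    (z0.1 + lam *: y) (rescale lam mu z0 w) =
  K / mu * quadop q c (mu / lam ^+ 2 * nu) A' E' E y w.
Proof.
have lN := gt_eqF lam0; have mN := gt_eqF mu0.
have Q1 := quad_rescale A' E' y w 0 (K / mu).
rewrite /quadop.
have -> : quad (fun t => K / mu * A' ((t - z0.2) / mu))
  (fun t => K / lam ^+ 2 / mu * E' ((t - z0.2) / mu)) (z0.1 + lam *: y)
  (rescale lam mu z0 w) = K / mu * quad A' E' y w.
  rewrite -[RHS]add0r -Q1 /quad !add0r; congr (_ + _ * _).
  by field; rewrite lN mN.
rewrite /rescale /=.
have -> : (z0.2 + mu * w.2 - z0.2) / mu = w.2 by field; rewrite mN.
have -> : z0.1 + lam *: w.1 - (z0.1 + lam *: y) = lam *: (w.1 - y).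
  by rewrite scalerBr opprD addrACA subrr add0r.
rewrite sqnormZ add0r normrM (gtr0_norm (divr_gt0 K0 (exprn_gt0 2 lam0))).
rewrite (powRM _ (sqr_ge0 lam) (sqnorm_ge0 _)).
have -> : (lam ^+ 2) `^ (q / 2) = lam `^ q.
  rewrite -powR_mulrn ?ltW// -powRrM; congr (_ `^ _); by field.
have KE : (2 * (K / lam ^+ 2 * `|E w.2|)) `^ q * lam `^ q =
          K / mu * (2 * `|E w.2|) `^ q.
  rewrite -balance -!powRM ?mulr_ge0 ?invr_ge0 ?exprn_ge0//.
  all: rewrite ?(ltW lam0) ?(ltW K0)//.
  by congr (_ `^ _); field; rewrite lN.
have -> : forall a b S : R, c * a * (b * S) = c * (a * b) * S.
  by move=> *; ring.
rewrite KE.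
by field; rewrite lN mN.
Qed.

Lemma near_rescale (P : set ('rV[R]_n * R)) (w : 'rV[R]_n * R) :
  (\forall v \near w, P (rescale lam mu z0 v)) ->
  \forall v \near rescale lam mu z0 w, P v.
Proof.
move=> hP.
pose inv := rescale lam^-1 mu^-1 (- lam^-1 *: z0.1, - (mu^-1 * z0.2)).
have invK : cancel inv (rescale lam mu z0).
  move=> v; rewrite /inv /rescale /= !scalerDr !scalerA mulrN.
  rewrite divff ?gt_eqF// scaleN1r addrA subrr add0r scale1r.
  rewrite (_ : z0.2 + _ = v.2); last by field; rewrite gt_eqF.
  by case: v.
have invE : inv (rescale lam mu z0 w) = w.
  rewrite /inv /rescale /= !scalerDr !scalerA addrA mulVf ?gt_eqF//.
  rewrite scaleNr addNr add0r scale1r.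
  rewrite (_ : _ + mu^-1 * _ = w.2); last by field; rewrite gt_eqF.
  by case: (w).
have := @continuous_rescale _ _ lam^-1 mu^-1
  (- lam^-1 *: z0.1, - (mu^-1 * z0.2)) (rescale lam mu z0 w).
rewrite /continuous_at -/inv invE => /(_ _ hP) /=.
rewrite /nbhs /= => H; apply: filterS H => v /=.
by rewrite invK.
Qed.

(** A test function touching the rescaled function corresponds to one of the same
    quadratic form touching the original function; this is where closure of the
    family of test functions under affine changes of variables is used. *)
Lemma quad_solution_rescale (delta nu eta : R) (O : set ('rV[R]_n * R))
    (u : 'rV[R]_n * R -> R) :
  quad_solution q delta nu eta O u ->
  quad_solution q delta (mu / lam ^+ 2 * nu) (mu / K * eta)
    (rescale lam mu z0 @^-1` O) (fun w => (u (rescale lam mu z0 w) - m) / K).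
Proof.
move=> [cu hsub hsup].
have KN := gt_eqF K0; have mN := gt_eqF mu0; have lN := gt_eqF lam0.
have Kmu : 0 < K / mu by exact: divr_gt0.
have E0E (E : R -> R) w : 0 + K / lam ^+ 2 *
    E (((rescale lam mu z0 w).2 - z0.2) / mu) = K / lam ^+ 2 * E w.2.
  rewrite add0r /rescale /=; congr (_ * E _); by field; rewrite mN.
split.
- move=> w Ow.
  have c1 := cvg_comp _ _ (@continuous_rescale _ _ lam mu z0 w) (cu _ Ow).
  by apply: cvgMr_tmp; exact: (cvgB c1 (cvg_cst _)).
- move=> A A' E E' y w hA hE Ow Ew hmax.
  have := hsub _ _ _ _ (z0.1 + lam *: y) _ (C1_with_affine m K mu z0.2 hA)
    (C1_with_affine 0 (K / lam ^+ 2) mu z0.2 hE) Ow.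
  rewrite E0E quadop_rescale => H.
  have : K / mu * quadop q delta^-1 (mu / lam ^+ 2 * nu) A' E' E y w <= eta.
    apply: H; first by rewrite mulr_ge0// divr_ge0 ?sqr_ge0 ?ltW.
    apply: near_rescale; apply: filterS hmax => v.
    rewrite !quad_rescale -(ler_pM2l K0).
    rewrite !mulrBr !(mulrC K (_ / K)) !divfK ?KN//; lra.
  by rewrite -ler_pdivlMl// invf_div.
- move=> A A' E E' y w hA hE Ow Ew hmin.
  have := hsup _ _ _ _ (z0.1 + lam *: y) _ (C1_with_affine m K mu z0.2 hA)
    (C1_with_affine 0 (K / lam ^+ 2) mu z0.2 hE) Ow.
  rewrite E0E quadop_rescale => H.
  have : - eta <= K / mu * quadop q delta (mu / lam ^+ 2 * nu) A' E' E y w.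
    apply: H; first by rewrite mulr_ge0_le0// divr_ge0 ?sqr_ge0 ?ltW.
    apply: near_rescale; apply: filterS hmin => v.
    rewrite !quad_rescale -(ler_pM2l K0).
    rewrite !mulrBr !(mulrC K (_ / K)) !divfK ?KN//; lra.
  by rewrite -ler_pdivrMl// invf_div mulrN.
Qed.

End scaling.

(** * Comparison on a box *)

Definition box (R : realType) (n : nat) (y : 'rV[R]_n) (l a b : R) :
    set ('rV[R]_n * R) :=
  [set w | `|w.1 - y| <= l /\ a <= w.2 <= b].

Lemma box_compact (R : realType) (n : nat) (y : 'rV[R]_n) (l a b : R) :
  compact (box y l a b).
Proof.
have -> : box y l a b = [set x | `|x - y| <= l] `*` `[a, b].
  by apply/seteqP; split=> w /=; rewrite in_itv.
apply: compact_setX; last exact: segment_compact.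
have -> : [set x | `|x - y| <= l] = (fun x => `|x - y|) @^-1` [set r | r <= l].
  by [].
apply: bounded_closed_compact.
  exists (l + `|y|); split; first exact: num_real.
  move=> r lr x /= xl; apply: le_trans (ltW lr).
  by rewrite -(subrK y x) (le_trans (ler_normD _ _))// lerD2r.
apply: closed_comp; last exact: closed_le.
move=> x _; exact: (cvg_norm (cvgB cvg_id (cvg_cst _))).
Qed.

Lemma box_near (R : realType) (n : nat) (y : 'rV[R]_n) (l a b : R)
    (z : 'rV[R]_n * R) :
  `|z.1 - y| < l -> a < z.2 < b -> \forall w \near z, box y l a b w.
Proof.
move=> zl /andP[az zb].
have c1 : (fst v) @[v --> z] --> z.1 by exact: cvg_fst.
have c2 : (snd v) @[v --> z] --> z.2 by exact: cvg_snd.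
have c3 : `|v.1 - y| @[v --> z] --> `|z.1 - y|.
  exact: (cvg_norm (cvgB c1 (cvg_cst _))).
have e1 : \forall v \near z, `|v.1 - y| < l by exact: (cvgr_lt _ c3).
have e2 : \forall v \near z, v.2 < b by exact: (cvgr_lt _ c2).
have e3 : \forall v \near z, a < v.2 by exact: (cvgr_gt _ c2).
near=> w; split; first by apply: ltW; near: w.
by apply/andP; split; apply: ltW; near: w.
Unshelve. all: by end_near.
Qed.

Lemma box_max_principle (R : realType) (n : nat) (y : 'rV[R]_n) (l a b : R)
    (f : 'rV[R]_n * R -> R) :
  (forall z, box y l a b z -> {for z, continuous f}) ->
  (forall z, box y l a b z -> `|z.1 - y| = l \/ z.2 = a \/ z.2 = b -> f z <= 0) ->
  (forall z : 'rV[R]_n * R, `|z.1 - y| < l -> a < z.2 < b ->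
     ~ (\forall w \near z, f w <= f z)) ->
  forall z, box y l a b z -> f z <= 0.
Proof.
move=> cf bd int z Bz.
have [c Bc cmax] : exists2 c, c \in box y l a b &
    forall t, t \in box y l a b -> f t <= f c.
  apply: compact_EVT_max.
  - by exists z.
  - exact: box_compact.
  - by apply: continuous_in_subspaceT => x /set_mem; exact: cf.
apply: le_trans (cmax z (mem_set Bz)) _.
move/set_mem: Bc => Bc; have [cl /andP[ac cb]] := Bc.
have [cl1|] := ltP `|c.1 - y| l; last first.
  by move=> lc; apply: bd => //; left; apply/le_anti/andP.
have [ac1|] := ltP a c.2; last first.
  by move=> lc; apply: bd => //; right; left; apply/le_anti/andP.
have [cb1|] := ltP c.2 b; last first.
  by move=> lc; apply: bd => //; right; right; apply/le_anti/andP.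
case: (int c cl1); first by rewrite ac1.
have hB := @box_near _ _ y l a b c cl1.
have : \forall w \near c, box y l a b w by apply: hB; rewrite ac1.
by apply: filterS => w Bw; apply: cmax; exact: mem_set.
Qed.

Section comparison.
Variables (R : realType) (n : nat) (q delta nu eta : R)
  (O : set ('rV[R]_n * R)) (u : 'rV[R]_n * R -> R)
  (A A' E E' : R -> R) (y : 'rV[R]_n) (l a b : R).
Hypotheses (hu : quad_solution q delta nu eta O u)
  (hA : C1_with A A') (hE : C1_with E E') (hO : box y l a b `<=` O).

Let near_box (z : 'rV[R]_n * R) : `|z.1 - y| < l -> a < z.2 < b -> box y l a b z.
Proof. by move=> h /andP[h1 h2]; split; rewrite ?ltW. Qed.

(** The final time counts as boundary here, so that an interior maximum of the
    difference is a local maximum in space and time and contradicts strictness.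
    The barriers are made large at the final time to satisfy this condition. *)
Lemma quad_supersolution_above :
  (forall z : 'rV[R]_n * R, `|z.1 - y| < l -> a < z.2 < b ->
     0 <= E z.2 /\ eta < quadop q delta^-1 nu A' E' E y z) ->
  (forall z, box y l a b z -> `|z.1 - y| = l \/ z.2 = a \/ z.2 = b ->
     u z <= quad A E y z) ->
  forall z, box y l a b z -> u z <= quad A E y z.
Proof.
case: hu => cu hsub _ strict bd z Bz; rewrite -subr_le0.
apply: (@box_max_principle _ _ y l a b (fun w => u w - quad A E y w)) Bz.
- move=> w Bw.
  have c1 : u v @[v --> w] --> u w by exact: cu _ (hO Bw).
  have c2 : quad A E y v @[v --> w] --> quad A E y w.
    exact: (continuous_quad hA hE).
  exact: (cvgB c1 c2).
- by move=> w Bw hw; rewrite subr_le0; exact: bd.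
- move=> w wl wab hmax; have [E0] := strict w wl wab.
  by rewrite ltNge (hsub _ _ _ _ _ _ hA hE (hO (near_box wl wab)) E0 hmax).
Qed.

Lemma quad_subsolution_below :
  (forall z : 'rV[R]_n * R, `|z.1 - y| < l -> a < z.2 < b ->
     E z.2 <= 0 /\ quadop q delta nu A' E' E y z < - eta) ->
  (forall z, box y l a b z -> `|z.1 - y| = l \/ z.2 = a \/ z.2 = b ->
     quad A E y z <= u z) ->
  forall z, box y l a b z -> quad A E y z <= u z.
Proof.
case: hu => cu _ hsup strict bd z Bz; rewrite -subr_le0.
apply: (@box_max_principle _ _ y l a b (fun w => quad A E y w - u w)) Bz.
- move=> w Bw.
  have c1 : u v @[v --> w] --> u w by exact: cu _ (hO Bw).
  have c2 : quad A E y v @[v --> w] --> quad A E y w.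
    exact: (continuous_quad hA hE).
  exact: (cvgB c2 c1).
- by move=> w Bw hw; rewrite subr_le0; exact: bd.
- move=> w wl wab hmax; have [E0] := strict w wl wab.
  have hmin : \forall v \near w, u w - quad A E y w <= u v - quad A E y v.
    by apply: filterS hmax => v; lra.
  by rewrite ltNge (hsup _ _ _ _ _ _ hA hE (hO (near_box wl wab)) E0 hmin).
Qed.

End comparison.

(** * The supersolution spreading a low value forward in time *)

(** The barrier involves negative powers of time but has to be smooth for all
    times; this positive function of time stays close to [t] for [t >= 0] when [k]
    is small. *)
Definition smooth_time (R : realType) (k t : R) : R :=
  (t + Num.sqrt (t ^+ 2 + k ^+ 2)) / 2.

Definition smooth_time' (R : realType) (k t : R) : R :=
  (1 + t / Num.sqrt (t ^+ 2 + k ^+ 2)) / 2.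

Section smooth_time.
Variables (R : realType) (k : R).
Hypothesis k0 : 0 < k.

Lemma smooth_radius_gt0 (t : R) : 0 < t ^+ 2 + k ^+ 2.
Proof. by rewrite ltr_wpDl ?sqr_ge0 ?exprn_gt0. Qed.

Lemma smooth_time_gt0 (t : R) : 0 < smooth_time k t.
Proof.
rewrite /smooth_time divr_gt0// -ltrBlDl sub0r.
apply: le_lt_trans (ler_norm _) _; rewrite normrN -sqrtr_sqr.
by rewrite ltr_sqrt ?smooth_radius_gt0// ltrDl exprn_gt0.
Qed.

Lemma smooth_time_ge (t : R) : t <= smooth_time k t.
Proof.
rewrite /smooth_time ler_pdivlMr//.
have : t <= Num.sqrt (t ^+ 2 + k ^+ 2); last by lra.
apply: le_trans (ler_norm _) _; rewrite -sqrtr_sqr ler_sqrt.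
  by rewrite lerDl sqr_ge0.
exact/ltW/smooth_radius_gt0.
Qed.

Lemma smooth_time_le (t : R) : 0 <= t -> smooth_time k t <= t + k.
Proof.
move=> t0; rewrite /smooth_time ler_pdivrMr//.
have : Num.sqrt (t ^+ 2 + k ^+ 2) <= t + k; last first.
  move=> h; have := k0; lra.
have tk : 0 <= t + k by rewrite addr_ge0// ltW.
have -> : t + k = Num.sqrt ((t + k) ^+ 2) by rewrite sqrtr_sqr ger0_norm.
rewrite ler_sqrt ?sqr_ge0//.
by rewrite sqrrD lerD2r lerDl mulrn_wge0// mulr_ge0// ltW.
Qed.

Lemma smooth_time_at0 : smooth_time k 0 = k / 2.
Proof. by rewrite /smooth_time expr0n /= !add0r sqrtr_sqr gtr0_norm. Qed.

Lemma smooth_time'_bounds (t : R) : 0 <= t -> 2^-1 <= smooth_time' k t <= 1.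
Proof.
move=> t0; rewrite /smooth_time'.
have r0 : 0 < Num.sqrt (t ^+ 2 + k ^+ 2) by rewrite sqrtr_gt0 smooth_radius_gt0.
have h0 : 0 <= t / Num.sqrt (t ^+ 2 + k ^+ 2) by rewrite divr_ge0// ltW.
have h1 : t / Num.sqrt (t ^+ 2 + k ^+ 2) <= 1.
  rewrite ler_pdivrMr// mul1r.
  have {1}-> : t = Num.sqrt (t ^+ 2) by rewrite sqrtr_sqr ger0_norm.
  rewrite ler_sqrt ?(ltW (smooth_radius_gt0 _))//.
  by rewrite lerDl sqr_ge0.
by move: h0 h1; set s := t / _ => h0 h1; apply/andP; split; lra.
Qed.

Lemma C1_smooth_time : C1_with (smooth_time k) (smooth_time' k).
Proof.
have dr (t : R) : is_derive t 1 (fun t : R => t ^+ 2 + k ^+ 2) (2 * t).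
  by apply: is_derive_eq; rewrite /GRing.scale /=; ring.
have ds (t : R) := @is_derive1_comp _ Num.sqrt (fun t : R => t ^+ 2 + k ^+ 2)
  t _ _ (is_derive1_sqrt (smooth_radius_gt0 t)) (dr t).
have cs : continuous (fun t : R => Num.sqrt (t ^+ 2 + k ^+ 2)).
  move=> t; apply: (@differentiable_continuous _ _ _ _
    (Num.sqrt \o (fun t : R => t ^+ 2 + k ^+ 2))).
  by apply/derivable1_diffP; case: (ds t).
have cc (t : R) : smooth_time' k s @[s --> t] --> smooth_time' k t.
  have r0 : Num.sqrt (t ^+ 2 + k ^+ 2) != 0.
    by rewrite gt_eqF// sqrtr_gt0 smooth_radius_gt0.
  have c1 : s / Num.sqrt (s ^+ 2 + k ^+ 2) @[s --> t] -->
            t / Num.sqrt (t ^+ 2 + k ^+ 2).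
    exact: (cvgM cvg_id (cvgV r0 (cs t))).
  have c2 : 1 + s / Num.sqrt (s ^+ 2 + k ^+ 2) @[s --> t] -->
            1 + t / Num.sqrt (t ^+ 2 + k ^+ 2).
    exact: (cvgD (cvg_cst _) c1).
  exact: (cvgMr_tmp c2).
split=> [t|]; last exact: cc.
have dk := is_deriveZ 2^-1 (is_deriveD (is_derive_id t 1) (ds t)).
  have -> : smooth_time k =
      2^-1 *: (id + (Num.sqrt \o (fun t : R => t ^+ 2 + k ^+ 2))).
    by apply/funext => s; rewrite /smooth_time /= mulrC.
  apply: (is_derive_eq dk).
  rewrite /smooth_time' /GRing.scale /=.
  have r0 : 0 < Num.sqrt (t ^+ 2 + k ^+ 2) by rewrite sqrtr_gt0 smooth_radius_gt0.
  by field; rewrite gt_eqF.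
Qed.

End smooth_time.

Lemma powR_expR (R : realType) (x c : R) : 0 < x -> x `^ c = expR (c * ln x).
Proof. by move=> x0; rewrite /powR gt_eqF. Qed.

Lemma C1_with_powR (R : realType) (G G' : R -> R) (c : R) :
  (forall t, 0 < G t) -> C1_with G G' ->
  C1_with (fun t => G t `^ c) (fun t => c * G t `^ (c - 1) * G' t).
Proof.
move=> G0 hG; have cG := C1_with_continuous hG; case: hG => dG cG'.
have E b : (fun t => G t `^ b) = fun t => expR (b * ln (G t)).
  by apply/funext => t; rewrite powR_expR.
have dl (t : R) := @is_derive1_comp _ (@ln R) G t _ _
  (is_derive1_ln (G0 t)) (dG t).
have de (b t : R) := @is_derive1_comp _ expR (b *: (@ln R \o G)) t _ _
  (is_derive_expR (b * ln (G t))) (is_deriveZ b (dl t)).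
have cp (t : R) : G s `^ (c - 1) @[s --> t] --> G t `^ (c - 1).
  have -> : G t `^ (c - 1) = expR ((c - 1) * ln (G t)) by rewrite powR_expR.
  rewrite E; apply: (@differentiable_continuous _ _ _ _
    (expR \o ((c - 1) *: (@ln R \o G)))).
  by apply/derivable1_diffP; case: (de (c - 1) t).
split=> [t|t]; last exact: (cvgM (cvgMl_tmp (cp t)) (cG' t)).
rewrite E.
apply: (is_derive_eq (de c t)).
have GN : G t != 0 by rewrite gt_eqF.
rewrite /GRing.scale /= -!powR_expR// powRB ?GN ?implybT//.
by rewrite powRr1 ?ltW//; field.
Qed.

(** Up to the factor [G `^ (- gam)] every term is a function of [X / G] and [g]: this
    determines [gam], which is half of the conjugate exponent of [q]. In the
    variable [X / G] the only term with the wrong sign that is not bounded is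
    linear, while the gradient term has the power [q / 2 > 1]. *)
Lemma forward_barrier_ineq (R : realType) (q delta nu C kap G g X : R) :
  2 < q -> 0 < delta -> 0 <= nu -> 0 < C -> 0 < G -> 2^-1 <= g <= 1 -> 0 <= X ->
  let gam := q / (2 * (q - 1)) in
  C * (gam + 2 * nu) <= (2 * C) `^ q / delta ->
  C * (gam + 2 * nu) <= kap * (1 - gam) / 2 ->
  0 <= kap * (1 - gam) * G `^ (- gam) * g
       + C * (- gam * G `^ (- gam - 1) * g) * X
       - 2 * (C * G `^ (- gam)) * nu
       + delta^-1 * (2 * (C * G `^ (- gam))) `^ q * X `^ (q / 2).
Proof.
move=> q2 d0 nu0 C0 G0 /andP[g1 g2] X0 gam h1 h2.
have q1 : q - 1 != 0 by rewrite gt_eqF//; lra.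
have gam0 : 0 < gam by rewrite divr_gt0//; lra.
have P0 : 0 < G `^ (- gam) by exact: powR_gt0.
pose Y := X / G.
have Y0 : 0 <= Y by rewrite divr_ge0// ltW.
have GN : G != 0 by rewrite gt_eqF.
have -> : G `^ (- gam - 1) = G `^ (- gam) / G.
  by rewrite powRB ?GN ?implybT// powRr1// ltW.
rewrite -[_ * _ * X `^ _]mulrA.
have -> : (2 * (C * G `^ (- gam))) `^ q * X `^ (q / 2)
   = G `^ (- gam) * ((2 * C) `^ q * Y `^ (q / 2)).
  rewrite mulrA powRM ?mulr_ge0 ?ltW// -powRrM.
  have -> : X = Y * G by rewrite /Y divfK.
  rewrite (powRM _ Y0 (ltW G0)).
  have E : G `^ (- gam * q) * G `^ (q / 2) = G `^ (- gam).
    rewrite -powRD ?GN ?implybT//; congr (_ `^ _); rewrite /gam; field.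
    by rewrite q1.
  by rewrite -E; ring.
set P := G `^ _ in P0 *; set Z := Y `^ _.
have Z0 : 0 <= Z by exact: powR_ge0.
have -> : kap * (1 - gam) * P * g + C * (- gam * (P / G) * g) * X
    - 2 * (C * P) * nu + delta^-1 * (P * ((2 * C) `^ q * Z))
  = P * (kap * (1 - gam) * g - C * gam * (g * Y) - 2 * C * nu
         + (2 * C) `^ q / delta * Z).
  by rewrite /Y; field; rewrite GN gt_eqF.
apply: mulr_ge0; first exact: ltW.
set B := _ / delta in h1 *.
have Cg : 0 < C * gam by exact: mulr_gt0.
have Cn : 0 <= C * nu by rewrite mulr_ge0// ltW.
have B0 : 0 < B by apply: lt_le_trans h1; lra.
have K0 : 0 < kap * (1 - gam) by lra.
have k1 : kap * (1 - gam) / 2 <= kap * (1 - gam) * g by rewrite ler_pM2l.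
have gY : g * Y <= Y by rewrite ler_piMl.
have Y1 : C * gam * (g * Y) <= C * gam * Y by rewrite ler_pM2l.
(* Below Y = 1 the growth of the constant term pays for everything, above it
   the superlinear gradient term does. *)
have [Yle|Yge] := leP Y 1.
  have : C * gam * Y <= C * gam by rewrite ler_piMr// ltW.
  have : 0 <= B * Z by rewrite mulr_ge0// ltW.
  by lra.
have YZ : Y <= Z.
  by rewrite /Z -[leLHS]powRr1// ler_powR ?ltW//; lra.
have : C * (gam + 2 * nu) * Y <= B * Z by rewrite ler_pM// ?addr_ge0//; lra.
have : C * nu <= C * nu * Y by rewrite ler_peMr// ltW.
by lra.
Qed.

Lemma C1_with_shift (R : realType) (A A' : R -> R) (s : R) :
  C1_with A A' -> C1_with (fun t => A (t + s)) (fun t => A' (t + s)).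
Proof.
move=> hA; have := C1_with_affine 0 1 1 (- s) hA.
have -> : (fun t => 0 + 1 * A ((t - - s) / 1)) = fun t => A (t + s).
  by apply/funext => t; rewrite add0r mul1r divr1 opprK.
have -> // : (fun t => 1 / 1 * A' ((t - - s) / 1)) = fun t => A' (t + s).
by apply/funext => t; rewrite !divr1 mul1r opprK.
Qed.

Lemma C1_withD (R : realType) (A A' B B' : R -> R) :
  C1_with A A' -> C1_with B B' ->
  C1_with (fun t => A t + B t) (fun t => A' t + B' t).
Proof.
move=> [dA cA] [dB cB]; split=> t; first exact: (is_deriveD (dA t) (dB t)).
exact: (cvgD (cA t) (cB t)).
Qed.

Lemma C1_withZ (R : realType) (A A' : R -> R) (c : R) :
  C1_with A A' -> C1_with (fun t => c * A t) (fun t => c * A' t).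
Proof.
move=> [dA cA]; split=> t; first exact: (is_deriveZ c (dA t)).
exact: (cvgMl_tmp (cA t)).
Qed.

Lemma C1_with_cst (R : realType) (c : R) : C1_with (fun=> c) (fun=> 0).
Proof. by split=> t; [exact: is_derive_cst | exact: cvg_cst]. Qed.

Lemma C1_with_id (R : realType) : C1_with (fun t : R => t) (fun=> 1).
Proof. by split=> t; [exact: is_derive_id | exact: cvg_cst]. Qed.

Lemma C1_with_pow4 (R : realType) :
  C1_with (fun t : R => t ^+ 4) (fun t => 4 * t ^+ 3).
Proof.
split=> t; last exact: (cvgMl_tmp (@exprn_continuous _ 3 t)).
apply: is_derive_eq; rewrite /GRing.scale /=; ring.
Qed.

Lemma sqnorm_le (R : realType) (n : nat) (d : 'rV[R]_n) (l : R) :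
  `|d| <= l -> sqnorm d <= n%:R * l ^+ 2.
Proof.
move=> dl; rewrite /sqnorm.
have -> : n%:R * l ^+ 2 = \sum_(i < n) l ^+ 2.
  by rewrite sumr_const card_ord mulr_natl.
apply: ler_sum => i _; rewrite -[leLHS]real_normK ?num_real//.
have di : `|d ord0 i| <= l.
  apply: le_trans dl; rewrite [leRHS]mx_normrE.
  by apply: (le_bigmax _ (fun ij => `|d ij.1 ij.2|) (ord0, i)).
by rewrite ler_sqr ?nnegrE// (le_trans _ di).
Qed.

Lemma sqnorm_ge (R : realType) (n : nat) (d : 'rV[R]_n) :
  `|d| ^+ 2 <= sqnorm d.
Proof.
have [->|d0] := eqVneq `|d| 0; first by rewrite expr0n /= sqnorm_ge0.
have [[i j] /= dE] := mx_norm_neq0 d0.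
have -> : `|d| = `|d i j| by exact: dE.
rewrite real_normK ?num_real// (ord1 i) /sqnorm (bigD1 j) //= lerDl.
by apply: sumr_ge0 => k _; exact: sqr_ge0.
Qed.

Section forward_spreading.
Variables (R : realType) (n : nat) (q delta nu eta e C kap T rho : R)
  (O : set ('rV[R]_n * R)) (v : 'rV[R]_n * R -> R) (y0 : 'rV[R]_n).
Let gam := q / (2 * (q - 1)).
Hypotheses (q2 : 2 < q) (d0 : 0 < delta) (nu0 : 0 <= nu) (eta_e : eta <= e)
  (e0 : 0 < e) (e16 : e <= 16^-1) (C4 : 4 <= C)
  (Cgrad : C * (gam + 2 * nu) <= (2 * C) `^ q / delta)
  (Ckap : C * (gam + 2 * nu) <= kap * (1 - gam) / 2)
  (T0 : 0 < T) (T8 : T <= 8^-1) (r0 : 0 < rho) (r2 : rho <= 2^-1)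
  (kapT : kap * (2 * T) `^ (1 - gam) <= 16^-1)
  (Crho : C * (n%:R * rho ^+ 2) * (T / 2) `^ (- gam) <= 16^-1).
Hypotheses (hv : quad_solution q delta nu eta O v)
  (hO : box y0 2^-1 (- T) (2 * T) `<=` O)
  (v1 : forall w, box y0 2^-1 (- T) (2 * T) w -> v w <= 1)
  (v0 : v (y0, - T) <= 2^-1).

Local Ltac lra_hyps :=
  move: (q2) (d0) (nu0) (eta_e) (e0) (e16) (C4) (T0) (T8) (r0) (r2);
  move=> ? ? ? ? ? ? ? ? ? ? ?; lra.

Section barrier.
Variable k : R.
Hypotheses (k0 : 0 < k).

Let G := smooth_time k.

(** The value at the start lies between the low value one half and the target
    [7 / 8]; the linear term makes the inequality strict and absorbs [eta]; the
    quartic term reaches one at the final time [3 * T] but is still small at half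
    that time; the last term pays for the spreading of the peak [barE]. *)
Definition barA (t : R) : R :=
  5 / 8 + 2 * e * t + (3 * T) ^- 4 * t ^+ 4 + kap * G t `^ (1 - gam).
Definition barA' (t : R) : R :=
  0 + 2 * e * 1 + (3 * T) ^- 4 * (4 * t ^+ 3)
  + kap * ((1 - gam) * G t `^ (1 - gam - 1) * smooth_time' k t).
Definition barE (t : R) : R := C * G t `^ (- gam).
Definition barE' (t : R) : R :=
  C * (- gam * G t `^ (- gam - 1) * smooth_time' k t).

Lemma C1_barA : C1_with barA barA'.
Proof.
have hG : C1_with G (smooth_time' k) by exact: C1_smooth_time.
do ![apply: C1_withD].
- exact: C1_with_cst.
- exact: (C1_withZ _ (C1_with_id R)).
- exact: (C1_withZ _ (C1_with_pow4 R)).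
- exact: (C1_withZ _ (C1_with_powR _ (smooth_time_gt0 k0) hG)).
Qed.

Lemma C1_barE : C1_with barE barE'.
Proof.
have hG : C1_with G (smooth_time' k) by exact: C1_smooth_time.
exact: (C1_withZ _ (C1_with_powR _ (smooth_time_gt0 k0) hG)).
Qed.

Lemma gam_bounds : 2^-1 < gam < 1.
Proof.
have q1 : 0 < 2 * (q - 1) by lra_hyps.
by rewrite /gam ltr_pdivlMr// ltr_pdivrMr//; apply/andP; split; lra_hyps.
Qed.

Lemma kap_gt0 : 0 < kap.
Proof.
have /andP[g1 g2] := gam_bounds.
have : 0 < C * (gam + 2 * nu) by rewrite mulr_gt0//; lra_hyps.
move=> H; have := Ckap => H'; have : 0 < kap * (1 - gam) by lra.
by rewrite pmulr_lgt0 // subr_gt0.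
Qed.

Lemma barE_ge0 t : 0 <= barE t.
Proof. by rewrite mulr_ge0 ?powR_ge0//; lra_hyps. Qed.

Lemma bar_strict (z : 'rV[R]_n * R) :
  - T < z.2 ->
  eta < quadop q delta^-1 nu (fun t => barA' (t + T)) (fun t => barE' (t + T))
          (fun t => barE (t + T)) y0 z.
Proof.
move=> zT; set t := z.2 + T.
have t0 : 0 <= t by rewrite /t; lra_hyps.
have := @forward_barrier_ineq _ q delta nu C kap (G t) (smooth_time' k t)
  (sqnorm (z.1 - y0)) q2 d0 nu0 _ (smooth_time_gt0 k0 t)
  (smooth_time'_bounds k0 t0) (sqnorm_ge0 _) Cgrad Ckap.
rewrite -/gam /quadop /quad -/t (ger0_norm (barE_ge0 _)) /barA' /barE' /barE.
have -> : 1 - gam - 1 = - gam by ring.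
have : 0 <= (3 * T) ^- 4 * (4 * t ^+ 3).
  by rewrite mulr_ge0 ?invr_ge0 ?mulr_ge0 ?exprn_ge0//; lra_hyps.
have C0 : 0 < C by lra_hyps.
move=> H1 /(_ C0) H2; lra_hyps.
Qed.

Lemma barA_ge t : 0 <= t -> 5 / 8 <= barA t.
Proof.
move=> t0; rewrite /barA -!addrA lerDl !addr_ge0//.
- by rewrite !mulr_ge0//; lra_hyps.
- by rewrite mulr_ge0 ?invr_ge0 ?exprn_ge0 ?mulr_ge0//; lra_hyps.
- by rewrite mulr_ge0 ?powR_ge0// ltW ?kap_gt0.
Qed.

Lemma bar_final t : k <= T / 2 -> T / 2 <= t <= 3 * T / 2 ->
  forall d : 'rV[R]_n, `|d| <= rho -> barA t + barE t * sqnorm d <= 7 / 8.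
Proof.
move=> kT /andP[t1 t2] d dr.
have /andP[g1 g2] := gam_bounds.
have G1 : T / 2 <= G t := le_trans t1 (smooth_time_ge k0 t).
have t0 : 0 <= t by lra_hyps.
have G2 : G t <= 2 * T by apply: le_trans (smooth_time_le k0 t0) _; lra_hyps.
have H1 : kap * G t `^ (1 - gam) <= 16^-1.
  apply: le_trans kapT; rewrite ler_pM2l ?kap_gt0// ge0_ler_powR//.
  - by rewrite subr_ge0 ltW.
  - by rewrite nnegrE; lra_hyps.
  - by rewrite nnegrE; lra_hyps.
have H2 : barE t * sqnorm d <= 16^-1.
  apply: le_trans Crho; rewrite /barE mulrAC ler_pM ?powR_ge0//.
  - by rewrite mulr_ge0 ?sqnorm_ge0//; lra_hyps.
  - by rewrite ler_pM2l ?sqnorm_le//; lra_hyps.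
  - have TG : (T / 2) `^ gam <= G t `^ gam.
      rewrite ge0_ler_powR//; rewrite ?nnegrE; lra_hyps.
    by rewrite !powRN lef_pV2// posrE powR_gt0//; lra_hyps.
have H3 : (3 * T) ^- 4 * t ^+ 4 <= 16^-1.
  have -> : (3 * T) ^- 4 * t ^+ 4 = (t / (3 * T)) ^+ 4.
    by rewrite expr_div_n mulrC.
  have -> : 16^-1 = (2^-1) ^+ 4 :> R by field.
  rewrite lerXn2r ?nnegrE ?divr_ge0//; try lra_hyps.
  by rewrite ler_pdivrMr; lra_hyps.
have H4 : 2 * e * t <= 16^-1.
  have : e * t <= 16^-1 * 2^-1 by rewrite ler_pM//; lra_hyps.
  by lra_hyps.
by rewrite /barA; lra_hyps.
Qed.

End barrier.

(** Only the value at [y0] is known to be small, but the peak of the barrier can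
    be made as narrow as the neighbourhood obtained here. *)
Lemma low_near_start :
  exists2 d, 0 < d & forall x, `|x - y0| < d -> v (x, - T) <= 5 / 8.
Proof.
have Bz : box y0 2^-1 (- T) (2 * T) (y0, - T).
  by split; rewrite /= ?subrr ?normr0 ?invr_ge0//; apply/andP; split; lra_hyps.
have [cv _ _] := hv.
have c1 : v w @[w --> (y0, - T)] --> v (y0, - T) by exact: cv _ (hO Bz).
have lt58 : v (y0, - T) < 5 / 8 by apply: le_lt_trans v0 _; lra.
have : \forall w \near (y0, - T), v w < 5 / 8 by exact: (cvgr_lt _ c1 _ lt58).
move=> /nbhs_normP[d /= dd hd]; exists d => // x xd.
apply/ltW/hd; rewrite /ball_ /= prod_normE /= subrr normr0 distrC.
by rewrite gt_max xd.
Qed.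

Lemma forward_spreading (w : 'rV[R]_n * R) :
  box y0 rho (- (T / 2)) (T / 2) w -> v w <= 7 / 8.
Proof.
have /andP[g1 g2] := gam_bounds.
have gam0 : 0 < gam by apply: lt_trans g1; rewrite invr_gt0.
have [d d1 hd] := low_near_start.
(* With this choice the barrier exceeds one at the initial time outside the
   ball of radius d where the solution is known to be small; the factor 2 comes
   from smooth_time k 0 = k / 2. *)
pose k := Num.min (T / 2) (2 * (d ^+ 2) `^ (gam^-1)).
have k0 : 0 < k.
  rewrite lt_min; apply/andP; split; first by lra_hyps.
  by rewrite mulr_gt0 ?powR_gt0 ?exprn_gt0.
have kT : k <= T / 2 by rewrite ge_min lexx.
have kd : (k / 2) `^ gam <= d ^+ 2.
  have -> : d ^+ 2 = ((d ^+ 2) `^ (gam^-1)) `^ gam.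
    by rewrite -powRrM mulVf ?gt_eqF// powRr1// sqr_ge0.
  rewrite ge0_ler_powR ?(ltW gam0)// ?nnegrE ?powR_ge0//; first by lra.
  by rewrite ler_pdivrMr// mulrC ge_min lexx orbT.
have shift t : - T <= t -> 0 <= t + T by rewrite -lerBlDr sub0r.
move=> Bw.
have bw : box y0 2^-1 (- T) (2 * T) w.
  case: Bw => wr /andP[w1 w2]; split; first by apply: le_trans wr r2.
  by apply/andP; split; lra_hyps.
apply: le_trans (quad_supersolution_above hv (C1_with_shift T (C1_barA k0))
  (C1_with_shift T (C1_barE k0)) hO _ _ bw) _; last first.
- case: Bw => wr /andP[w1 w2]; rewrite /quad; apply: bar_final => //.
  by apply/andP; split; lra_hyps.
- move=> z Bz; have [zl /andP[z1 z2]] := Bz.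
  have v1z := v1 Bz; have sz := shift _ z1.
  have A58 := barA_ge k sz.
  have EX : 0 <= barE k (z.2 + T) * sqnorm (z.1 - y0).
    by rewrite mulr_ge0 ?barE_ge0 ?sqnorm_ge0.
  rewrite /quad; case=> [zl2|[zT|zT]].
  + have X4 : 4^-1 <= sqnorm (z.1 - y0).
      by apply: le_trans (sqnorm_ge _); rewrite zl2; lra.
    have G1 : smooth_time k (z.2 + T) <= 1.
      by apply: le_trans (smooth_time_le k0 sz) _; lra_hyps.
    have P1 : 1 <= smooth_time k (z.2 + T) `^ (- gam).
      have G0 := smooth_time_gt0 k0 (z.2 + T).
      rewrite powRN invf_ge1 ?powR_gt0//.
      have := ge0_ler_powR (ltW gam0) _ _ G1; rewrite !nnegrE powR1.
      by apply; rewrite ?ler01// ltW.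
    have : 4 * 1 * 4^-1 <= barE k (z.2 + T) * sqnorm (z.1 - y0).
      by rewrite ler_pM// ler_pM.
    by lra.
  + have zE : z = (z.1, - T) by rewrite -zT; case: (z).
    have [zd|dz] := ltP `|z.1 - y0| d.
      have := hd _ zd; rewrite -zE; lra.
    have X4 : d ^+ 2 <= sqnorm (z.1 - y0).
      by apply: le_trans (sqnorm_ge _); rewrite ler_sqr ?nnegrE// ltW.
    have P1 : (d ^+ 2)^-1 <= smooth_time k (z.2 + T) `^ (- gam).
      rewrite zT addNr smooth_time_at0// powRN lef_pV2// posrE ?exprn_gt0//.
      by rewrite powR_gt0 ?divr_gt0.
    have : 4 * (d ^+ 2)^-1 * d ^+ 2 <= barE k (z.2 + T) * sqnorm (z.1 - y0).
      have dd0 : 0 <= (d ^+ 2)^-1 by rewrite invr_ge0 sqr_ge0.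
      apply: ler_pM => //; [exact: mulr_ge0 | exact: sqr_ge0 |].
      by rewrite /barE; apply: ler_pM.
    rewrite divfK ?gt_eqF ?exprn_gt0//; lra.
  + have : 1 <= barA k (z.2 + T); last by lra.
    rewrite /barA zT.
    have -> : 2 * T + T = 3 * T by ring.
    rewrite mulVf ?expf_neq0 ?mulf_neq0 ?(gt_eqF T0)//.
    have : 0 <= 2 * e * (3 * T) by rewrite !mulr_ge0//; lra_hyps.
    have : 0 <= kap * smooth_time k (3 * T) `^ (1 - gam).
      by rewrite mulr_ge0 ?powR_ge0// ltW ?kap_gt0.
    by lra.
- move=> z zl /andP[z1 z2]; split; first exact: barE_ge0.
  exact: bar_strict.
Qed.

End forward_spreading.

(** * The subsolution preserving a high value *)

(** The paraboloid [c (1 - |x - x0|^2 / rr^2)] is lowered at speed [c / 4]. For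
    [c] small this beats its gradient term, which is of order [c `^ q] with
    [q > 1], and the quartic term brings it below zero at the final time. *)
Lemma high_value_persists (R : realType) (n : nat)
    (q delta nu eta c rr r T : R) (O : set ('rV[R]_n * R))
    (v : 'rV[R]_n * R -> R) (x0 : 'rV[R]_n) :
  0 < q -> 0 < delta -> 0 <= nu -> 0 < c -> c <= 2^-1 -> 0 < rr ->
  0 < T -> T <= 8^-1 -> 0 <= r -> n%:R * r ^+ 2 <= rr ^+ 2 / 4 -> r <= rr ->
  delta * (2 * (c / rr ^+ 2)) `^ q * (n%:R * rr ^+ 2) `^ (q / 2) <= c / 16 ->
  2 * nu / rr ^+ 2 <= 16^-1 -> eta <= c / 16 ->
  quad_solution q delta nu eta O v ->
  box x0 rr (- T) (2 * T) `<=` O ->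
  (forall w, box x0 rr (- T) (2 * T) w -> 0 <= v w) ->
  (forall x, `|x - x0| <= rr -> 2^-1 <= v (x, - T)) ->
  forall w, box x0 r (- (T / 2)) (T / 2) w -> c / 4 <= v w.
Proof.
move=> q0 d0 nu0 c0 c2 rr0 T0 T8 r0 nr rrr hq hnu heta hv hO v0 vT w Bw.
have rr20 : 0 < rr ^+ 2 by exact: exprn_gt0.
pose A t := c + - (c / 4) * (t + T) + - (c * (3 * T) ^- 4) * (t + T) ^+ 4.
pose A' t := 0 + - (c / 4) * 1 + - (c * (3 * T) ^- 4) * (4 * (t + T) ^+ 3).
have hA : C1_with A A'.
  apply: (C1_with_shift T (A := fun t =>
    c + - (c / 4) * t + - (c * (3 * T) ^- 4) * t ^+ 4)
    (A' := fun t => 0 + - (c / 4) * 1 + - (c * (3 * T) ^- 4) * (4 * t ^+ 3))).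
  do ![apply: C1_withD].
  - exact: C1_with_cst.
  - exact: (C1_withZ _ (C1_with_id R)).
  - exact: (C1_withZ _ (C1_with_pow4 R)).
have T4 : 0 < (3 * T) ^- 4 by rewrite invr_gt0 exprn_gt0// mulr_gt0.
have hE := C1_with_cst (- (c / rr ^+ 2)).
have E0 : - (c / rr ^+ 2) <= 0 by rewrite oppr_le0 ltW// divr_gt0.
have bw : box x0 rr (- T) (2 * T) w.
  case: Bw => wr /andP[w1 w2]; split; first exact: le_trans wr rrr.
  by apply/andP; split; lra.
apply: le_trans (quad_subsolution_below hv hA hE hO _ _ bw).
- case: Bw => wr /andP[w1 w2]; rewrite /quad /A.
  set t := w.2 + T.
  have [t1 t2] : 0 <= t /\ t <= 3 * T / 2 by rewrite /t; split; lra.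
  have H1 : c / rr ^+ 2 * sqnorm (w.1 - x0) <= c / 4.
    rewrite mulrAC ler_pdivrMr//.
    have : sqnorm (w.1 - x0) <= rr ^+ 2 / 4.
      exact: le_trans (sqnorm_le wr) nr.
    by move=> /(ler_wpM2l (ltW c0)); lra.
  have H3 : (3 * T) ^- 4 * t ^+ 4 <= 16^-1.
    have -> : (3 * T) ^- 4 * t ^+ 4 = (t / (3 * T)) ^+ 4.
      by rewrite expr_div_n mulrC.
    have -> : 16^-1 = (2^-1) ^+ 4 :> R by field.
    rewrite lerXn2r ?nnegrE ?divr_ge0//; try lra.
    by rewrite ler_pdivrMr; lra.
  have H4 : c * ((3 * T) ^- 4 * t ^+ 4) <= c * 16^-1 by rewrite ler_pM2l.
  have H5 : c * t <= c * (3 / 16) by rewrite ler_pM2l//; lra.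
  by lra.
- move=> z zl /andP[z1 z2]; split=> //.
  rewrite /quadop /quad /A' mul0r addr0 normrN (gtr0_norm (divr_gt0 c0 rr20)).
  set t := z.2 + T; have t0 : 0 <= t by rewrite /t; lra.
  have H1 : delta * (2 * (c / rr ^+ 2)) `^ q * sqnorm (z.1 - x0) `^ (q / 2)
     <= c / 16.
    apply: le_trans hq; rewrite ler_wpM2l ?mulr_ge0 ?powR_ge0 ?(ltW d0)//.
    have q20 : 0 <= q / 2 by rewrite divr_ge0// ltW.
    have n0 : 0 <= n%:R * rr ^+ 2 by exact: mulr_ge0 (ler0n _ _) (ltW rr20).
    apply: (ge0_ler_powR q20); rewrite ?nnegrE ?sqnorm_ge0//.
    exact: sqnorm_le (ltW zl).
  have H2 : c * (2 * nu / rr ^+ 2) <= c * 16^-1 by rewrite ler_pM2l.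
  have H3 : 0 <= c * (3 * T) ^- 4 * (4 * t ^+ 3).
    by rewrite !mulr_ge0 ?exprn_ge0 ?(ltW T4) ?(ltW c0).
  have H4 : - (2 * - (c / rr ^+ 2) * nu) = c * (2 * nu / rr ^+ 2) by ring.
  by rewrite H4; lra.
- move=> z Bz; have [zl /andP[z1 z2]] := Bz.
  have v0z := v0 _ Bz; rewrite /quad /A; set t := z.2 + T => hz.
  have t0 : 0 <= t by rewrite /t; lra.
  have ct : 0 <= c / 4 * t by rewrite mulr_ge0//; lra.
  have ct4 : 0 <= c * (3 * T) ^- 4 * t ^+ 4.
    by rewrite !mulr_ge0 ?exprn_ge0 ?(ltW T4) ?(ltW c0).
  have X0 : 0 <= c / rr ^+ 2 * sqnorm (z.1 - x0).
    by rewrite mulr_ge0 ?sqnorm_ge0// ltW// divr_gt0.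
  case: hz => [zl2|[zT|zT]].
  + have : c / rr ^+ 2 * rr ^+ 2 <= c / rr ^+ 2 * sqnorm (z.1 - x0).
      by rewrite ler_pM2l ?divr_gt0// -zl2; exact: sqnorm_ge.
    by rewrite divfK ?gt_eqF//; lra.
  + have zE : z = (z.1, - T) by rewrite -zT; case: (z).
    have := vT _ zl; rewrite -zE; lra.
  + have : c * (3 * T) ^- 4 * t ^+ 4 = c; last by lra.
    have -> : t = 3 * T by rewrite /t zT; ring.
    by rewrite divfK// expf_neq0// mulf_neq0// gt_eqF.
Qed.

(** * Decay of oscillation *)

Lemma small_linear (R : realType) (B e : R) : 0 <= B -> 0 < e ->
  exists2 c, 0 < c & c <= 2^-1 /\ B * c <= e.
Proof.
move=> B0 e0; exists (Num.min 2^-1 (e / (B + 1))).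
  by rewrite lt_min invr_gt0 ltr0n /= divr_gt0// ltr_wpDl.
split; first by rewrite ge_min lexx.
apply: (@le_trans _ _ ((B + 1) * (e / (B + 1)))).
  apply: ler_pM => //; rewrite ?lerDl ?ge_min ?lexx ?orbT//.
  by rewrite le_min invr_ge0 ler0n /= divr_ge0 ?(ltW e0)// addr_ge0.
by rewrite mulrC divfK// gt_eqF// ltr_wpDl.
Qed.

Lemma small_power (R : realType) (K b e : R) : 0 < K -> 0 < b -> 0 < e ->
  exists2 T, 0 < T & T <= 8^-1 /\ K * (2 * T) `^ b <= e.
Proof.
move=> K0 b0 e0; have eK : 0 < e / K by exact: divr_gt0.
exists (Num.min 8^-1 ((e / K) `^ b^-1 / 2)).
  by rewrite lt_min invr_gt0 ltr0n /= divr_gt0// powR_gt0.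
split; first by rewrite ge_min lexx.
rewrite mulrC -ler_pdivlMr//.
have eE : e / K = ((e / K) `^ b^-1) `^ b.
  by rewrite -powRrM mulVf ?gt_eqF// powRr1// ltW.
rewrite [leRHS]eE.
apply: (ge0_ler_powR (ltW b0)); rewrite ?nnegrE ?powR_ge0//.
  by rewrite mulr_ge0// le_min invr_ge0 ler0n /= divr_ge0// powR_ge0.
set X := _ `^ _; have : Num.min 8^-1 (X / 2) <= X / 2 by rewrite ge_min lexx orbT.
by lra.
Qed.

Lemma powR_le_square (R : realType) (q x : R) :
  2 <= q -> 0 <= x <= 1 -> x `^ q <= x ^+ 2.
Proof.
move=> q2 /andP[x0 x1]; rewrite -powR_mulrn//.
have [->|xN] := eqVneq x 0.
  by rewrite !powR0 ?pnatr_eq0//; apply/eqP; lra.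
have xp : 0 < x by rewrite lt_neqAle eq_sym xN.
by apply: ger_powR => //; rewrite xp.
Qed.

Lemma square_le_powR (R : realType) (q x : R) :
  2 <= q -> 1 <= x -> x ^+ 2 <= x `^ q.
Proof.
by move=> q2 x1; rewrite -powR_mulrn ?ler_powR// (le_trans _ x1).
Qed.

(** The constants are chosen in the order [C], [kap], [T], [rho], each depending
    on the previous ones only. *)
Lemma forward_spreading_uniform (R : realType) (n : nat) (q delta : R) :
  2 < q -> 0 < delta -> exists T rho : R,
  [/\ 0 < T <= 8^-1, 0 < rho <= 2^-1 &
  forall nu eta O v (y0 : 'rV[R]_n), 0 <= nu <= 1 -> eta <= 16^-1 ->
    quad_solution q delta nu eta O v ->
    box y0 2^-1 (- T) (2 * T) `<=` O ->
    (forall w, box y0 2^-1 (- T) (2 * T) w -> v w <= 1) ->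
    v (y0, - T) <= 2^-1 ->
    forall w, box y0 rho (- (T / 2)) (T / 2) w -> v w <= 7 / 8].
Proof.
move=> q2 d0.
pose g := q / (2 * (q - 1)).
have [g1 g2] : 2^-1 < g /\ g < 1.
  have q1 : 0 < 2 * (q - 1) by lra.
  by rewrite /g ltr_pdivlMr// ltr_pdivrMr//; split; lra.
pose C := 4 + 3 * delta.
have C4 : 4 <= C by rewrite /C; lra.
pose kap := 6 * C / (1 - g).
have kap0 : 0 < kap by rewrite divr_gt0//; lra.
have C3 nu : 0 <= nu <= 1 -> C * (g + 2 * nu) <= 3 * C.
  by move=> /andP[? ?]; rewrite mulrC ler_pM2r//; lra.
have Cgrad nu : 0 <= nu <= 1 -> C * (g + 2 * nu) <= (2 * C) `^ q / delta.
  move=> /C3 h; apply: le_trans h _; rewrite ler_pdivlMr//.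
  apply: (@le_trans _ _ ((2 * C) ^+ 2)); last by apply: square_le_powR; lra.
  have : C * (3 * delta) <= C * C by rewrite ler_pM2l /C; lra.
  have : 0 <= C * C by apply: mulr_ge0; lra.
  by rewrite expr2; lra.
have Ckap nu : 0 <= nu <= 1 -> C * (g + 2 * nu) <= kap * (1 - g) / 2.
  move=> /C3 h; apply: le_trans h _; rewrite /kap divfK; last first.
    by rewrite gt_eqF// subr_gt0.
  lra.
have [T T0 [T8 kapT]] : exists2 T, 0 < T &
    T <= 8^-1 /\ kap * (2 * T) `^ (1 - g) <= 16^-1.
  by apply: small_power => //; lra.
have Pg0 : 0 <= (T / 2) `^ (- g) by exact: powR_ge0.
have B0 : 0 <= C * n%:R * (T / 2) `^ (- g).
  by rewrite !mulr_ge0//; lra.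
have e16 : 0 < 16^-1 :> R by rewrite invr_gt0.
have [rho rho0 [rho2 Crho]] := small_linear B0 e16.
have Crho2 : C * (n%:R * rho ^+ 2) * (T / 2) `^ (- g) <= 16^-1.
  apply: le_trans Crho.
  have -> : C * (n%:R * rho ^+ 2) * (T / 2) `^ (- g) =
            C * n%:R * (T / 2) `^ (- g) * rho * rho by ring.
  by rewrite ler_piMr ?mulr_ge0//; lra.
exists T, rho; split; rewrite ?T0 ?rho0//.
move=> nu eta O v y0 nu01 etae hv hO hv1 v0 w.
have /andP[nu0 _] := nu01.
exact: (@forward_spreading _ _ q delta nu eta 16^-1 C kap T rho O v y0 q2 d0 nu0
  etae e16 (lexx _) C4 (Cgrad _ nu01) (Ckap _ nu01) T0 T8 rho0 rho2
  kapT Crho2 hv hO hv1 v0 w).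
Qed.

Lemma high_value_persists_uniform (R : realType) (n : nat)
    (q delta T rr r : R) :
  2 < q -> 0 < delta ->
  0 < T <= 8^-1 -> 0 < rr -> 0 <= r <= rr -> n%:R * r ^+ 2 <= rr ^+ 2 / 4 ->
  exists c eps : R, [/\ 0 < c <= 2^-1, 0 < eps &
  forall nu eta O v (x0 : 'rV[R]_n), 0 <= nu <= eps -> eta <= eps ->
    quad_solution q delta nu eta O v ->
    box x0 rr (- T) (2 * T) `<=` O ->
    (forall w, box x0 rr (- T) (2 * T) w -> 0 <= v w) ->
    (forall x, `|x - x0| <= rr -> 2^-1 <= v (x, - T)) ->
    forall w, box x0 r (- (T / 2)) (T / 2) w -> c / 4 <= v w].
Proof.
move=> q2 d0 /andP[T0 T8] rr0 /andP[r0 rrr] nr.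
have q2' : 2 <= q by exact: ltW.
have q0 : 0 < q by exact: lt_trans q2.
have rr20 : 0 < rr ^+ 2 by rewrite exprn_gt0.
have e16 : 0 < 16^-1 :> R by rewrite invr_gt0.
pose B := delta * (2 / rr ^+ 2) `^ q * (n%:R * rr ^+ 2) `^ (q / 2).
have B1 : 0 <= B by rewrite !mulr_ge0 ?powR_ge0 ?(ltW d0).
have [c c0 [c2 Bc]] := small_linear B1 e16.
pose eps := Num.min (rr ^+ 2 / 32) (c / 16).
have [ep2 ep3] : eps <= rr ^+ 2 / 32 /\ eps <= c / 16.
  by rewrite /eps; split; rewrite !ge_min lexx ?orbT.
exists c, eps; split; rewrite ?c0 ?c2//; first by rewrite !lt_min !divr_gt0.
move=> nu eta O v x0 /andP[nu0 nue] etae hv hO v0 vT.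
apply: (high_value_persists q0 d0 nu0 c0 c2 rr0 T0 T8 r0 nr rrr _ _ _ hv) => //.
- have -> : 2 * (c / rr ^+ 2) = c * (2 / rr ^+ 2) by ring.
  rewrite (powRM _ (ltW c0) (divr_ge0 (ler0n _ 2) (ltW rr20))).
  have cq : c `^ q <= c ^+ 2.
    apply: powR_le_square => //; rewrite ltW//=.
    by apply: le_trans c2 _; rewrite invf_le1 ?ler1n.
  have -> : forall x y z : R, delta * (x * y) * z = delta * y * z * x.
    by move=> *; ring.
  rewrite -/B; apply: (@le_trans _ _ (B * c ^+ 2)); first by rewrite ler_wpM2l.
  by rewrite expr2 mulrA mulrC ler_pM2l.
- have := le_trans nue ep2; rewrite ler_pdivrMr//; clear -R; lra.
- exact: le_trans etae ep3.
Qed.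

(** At time [- T] the solution is either low somewhere near the centre, and then
    the gradient term forces it down nearby, or high everywhere near the centre,
    and then it has no time to come down. *)
Lemma oscillation_decay_step (R : realType) (n : nat) (q delta : R) :
  2 < q -> 0 < delta -> (0 < n)%N -> exists eps sig gam : R,
  [/\ 0 < eps, 0 < sig <= 2^-1, 0 < gam < 1 &
  forall nu eta O v, 0 <= nu <= eps -> eta <= eps ->
    quad_solution q delta nu eta O v -> box (0 : 'rV[R]_n) 1 (- 1) 1 `<=` O ->
    (forall w, box (0 : 'rV[R]_n) 1 (- 1) 1 w -> 0 <= v w <= 1) ->
    exists m, forall w, box (0 : 'rV[R]_n) sig (- sig) sig w ->
      m <= v w <= m + gam].
Proof.
move=> q2 d0 n0.
have n1 : 1 <= n%:R :> R by rewrite ler1n.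
have [T [rho [Tb rhob spread]]] :=
  @forward_spreading_uniform R n q delta q2 d0.
have /andP[T0 T8] := Tb; have /andP[rho0 rho2] := rhob.
(* The squared Euclidean norm is at most n times the square of the sup norm,
   which is the one defining the boxes. *)
pose rr := rho / 2; pose r := rr / (2 * n%:R).
have rrE : rho = 2 * rr by rewrite /rr mulrC divfK.
have rr0 : 0 < rr by rewrite divr_gt0.
have nN : n%:R != 0 :> R by rewrite gt_eqF// ltr0n.
have r0 : 0 < r by rewrite divr_gt0// mulr_gt0// ltr0n.
have rrr : 2 * r <= rr.
  by rewrite /r invfM mulrCA mulVKf// ler_pdivrMr ?ltr0n// ler_peMr// ltW.
have nr : n%:R * r ^+ 2 <= rr ^+ 2 / 4.
  have -> : n%:R * r ^+ 2 = rr ^+ 2 / 4 / n%:R by rewrite /r; field.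
  by rewrite ler_pdivrMr ?ltr0n// ler_peMr ?divr_ge0 ?sqr_ge0.
have rrb : 0 <= r <= rr by apply/andP; split; lra.
have [c [eps1 [cb eps0 persist]]] :=
  high_value_persists_uniform q2 d0 Tb rr0 rrb nr.
have /andP[c0 c2] := cb.
pose eps := Num.min 16^-1 eps1.
have [ep1 ep2] : eps <= 16^-1 /\ eps <= eps1.
  by rewrite /eps; split; rewrite !ge_min lexx ?orbT.
pose sig := Num.min r (T / 2).
have [sr sT] : sig <= r /\ sig <= T / 2.
  by rewrite /sig; split; rewrite !ge_min lexx ?orbT.
have s0 : 0 < sig by rewrite lt_min r0 divr_gt0.
exists eps, sig, (1 - c / 4); split.
- by rewrite !lt_min eps0 invr_gt0 ltr0n.
- by rewrite s0; clear -sT T8; lra.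
- by clear -c0 c2; apply/andP; split; lra.
clearbody eps sig r rr.
move=> nu eta O v /andP[nu0 nue] etae hv hO hv01.
have [[y0 [yr vy]]|high] := pselect (exists y0 : 'rV[R]_n,
    `|y0| <= rr /\ v (y0, - T) <= 2^-1).
- have sub w : box y0 2^-1 (- T) (2 * T) w -> box (0 : 'rV[R]_n) 1 (- 1) 1 w.
    move=> [w1 /andP[w2 w3]].
    split; last by clear -w2 w3 T0 T8; apply/andP; split; lra.
    rewrite subr0 -(subrK y0 w.1) (le_trans (ler_normD _ _))//.
    by clear -w1 yr rrE rho2; lra.
  exists 0 => w [w1 /andP[w2 w3]].
  have w01 : box (0 : 'rV[R]_n) 1 (- 1) 1 w.
    by clear -w1 w2 w3 sr sT rrr rr0 rrE rho2 T8;
      split; [lra | apply/andP; split; lra].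
  have /andP[-> _] := hv01 _ w01.
  suff : v w <= 7 / 8 by clear -c2; rewrite add0r; lra.
  apply: (spread nu eta O v y0) => //.
  + by clear -nu0 nue ep1; apply/andP; split; lra.
  + exact: le_trans etae ep1.
  + by move=> z /sub; exact: hO.
  + by move=> z /sub /hv01 /andP[].
  + split; last by clear -w2 w3 sT; apply/andP; split; lra.
    rewrite (le_trans (ler_normB _ _))//.
    by move: w1; rewrite subr0; clear -yr sr rrr rr0 rrE; lra.
- have sub w : box 0 rr (- T) (2 * T) w -> box (0 : 'rV[R]_n) 1 (- 1) 1 w.
    move=> [w1 /andP[w2 w3]].
    by clear -w1 w2 w3 T0 T8 rrE rho2; split; [lra | apply/andP; split; lra].
  exists (c / 4) => w [w1 /andP[w2 w3]].
  have w01 : box (0 : 'rV[R]_n) 1 (- 1) 1 w.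
    by clear -w1 w2 w3 sr sT rrr rr0 rrE rho2 T8;
      split; [lra | apply/andP; split; lra].
  have /andP[_ wle1] := hv01 _ w01.
  apply/andP; split; last by clear -wle1; lra.
  apply: (persist nu eta O v 0) => //.
  + by rewrite nu0 (le_trans nue).
  + exact: le_trans etae ep2.
  + by move=> z /sub; exact: hO.
  + by move=> z /sub /hv01 /andP[].
  + move=> x; rewrite subr0 => xr; rewrite leNgt; apply/negP => lt.
    by apply: high; exists x; split=> //; exact: ltW.
  + split; first exact: le_trans w1 sr.
    by clear -w2 w3 sT; apply/andP; split; lra.
Qed.

(** * Hoelder estimate on the unit box *)

(** When space is shrunk by [l] and values by [l `^ al], the balance between time
    derivative and gradient term forces time to be shrunk by [l] to this power. *)
Definition rate_t (R : realType) (q al : R) : R := q - al * (q - 1).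

(** The condition [al <= (q - 2) / (q - 1)] says that [rate_t q al >= 2], so the
    diffusion does not grow under rescaling and the one-step estimate can be
    applied again to the rescaled solution. *)
Lemma geometric_decay (R : realType) (n : nat) (q delta : R) :
  2 < q -> 0 < delta -> (0 < n)%N -> exists eps sig al : R,
  [/\ 0 < eps, 0 < sig <= 2^-1, 0 < al <= (q - 2) / (q - 1) &
  forall k nu eta O v, 0 <= nu <= eps -> 0 <= eta <= eps ->
    quad_solution q delta nu eta O v -> box (0 : 'rV[R]_n) 1 (- 1) 1 `<=` O ->
    (forall w, box (0 : 'rV[R]_n) 1 (- 1) 1 w -> 0 <= v w <= 1) ->
    exists m, forall w,
      box (0 : 'rV[R]_n) (sig ^+ k) (- (sig `^ rate_t q al) ^+ k)
        ((sig `^ rate_t q al) ^+ k) w ->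
      m <= v w <= m + (sig `^ al) ^+ k].
Proof.
move=> q2 d0 n0.
have [eps [sig [gam [eps0 sigb gamb step]]]] := oscillation_decay_step q2 d0 n0.
have /andP[s0 s2] := sigb; have /andP[g0 g1] := gamb.
have s1 : sig < 1 by clear -s2; lra.
have s01 : 0 < sig <= 1 by rewrite s0 ltW.
have ls : ln sig < 0 by rewrite ln_lt0// s0.
have lg : ln gam < 0 by rewrite ln_lt0// g0.
pose al := Num.min (ln gam / ln sig) ((q - 2) / (q - 1)).
have q1 : 0 < q - 1 by clear -q2; lra.
have al0 : 0 < al.
  rewrite lt_min -mulrNN -invrN divr_gt0 ?oppr_gt0//=.
  by rewrite divr_gt0//; clear -q2; lra.
have [al1 al2] : al <= ln gam / ln sig /\ al <= (q - 2) / (q - 1).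
  by rewrite /al; split; rewrite !ge_min lexx ?orbT.
have gs : gam <= sig `^ al.
  rewrite powR_expR// -[leLHS]lnK ?posrE// ler_expR.
  by rewrite -ler_ndivlMr.
clearbody al.
have al2' : al * (q - 1) <= q - 2 by rewrite -ler_pdivlMr.
have be2 : 2 <= rate_t q al by rewrite /rate_t; clear -al2'; lra.
have alb : al <= 1.
  by apply: le_trans al2 _; rewrite ler_pdivrMr//; clear -q2; lra.
exists eps, sig, al; split=> //; first by rewrite al0.
set b := sig `^ rate_t q al; set s := sig `^ al.
have b0 : 0 < b by exact: powR_gt0.
have sp : 0 < s by exact: powR_gt0.
have bs2 : b <= sig ^+ 2.
  by rewrite /b -powR_mulrn ?(ltW s0)//; apply: ger_powR.
have bsig : b <= sig.
  by apply: le_trans bs2 _; rewrite expr2 ler_piMr ?ltW.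
have bs : b <= s.
  apply: ger_powR => //; apply: (le_trans alb); apply: le_trans be2.
  by rewrite ler1n.
have bal : (s / sig) `^ q = s / b.
  have sN : sig != 0 by rewrite gt_eqF.
  have -> : s / sig = sig `^ (al - 1).
    by rewrite powRB ?sN ?implybT// powRr1// ltW.
  rewrite -powRrM /s /b -powRB ?sN ?implybT//; congr (_ `^ _).
  by rewrite /rate_t; ring.
have rescale0 w : rescale sig b 0 w = (sig *: w.1, b * w.2).
  by rewrite /rescale /= !add0r.
have sub w : box (0 : 'rV[R]_n) 1 (- 1) 1 w ->
    box (0 : 'rV[R]_n) sig (- sig) sig (rescale sig b 0 w).
  rewrite rescale0 /box /= !subr0 normrZ (gtr0_norm s0) -!ler_norml.
  move=> [w1 w2]; split; first by rewrite ler_piMr// ltW.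
  by rewrite normrM (gtr0_norm b0) (le_trans _ bsig)// ler_piMr// ltW.
have sub1 w : box (0 : 'rV[R]_n) sig (- sig) sig w ->
    box (0 : 'rV[R]_n) 1 (- 1) 1 w.
  move=> [w1 w2]; split; first exact: le_trans w1 (ltW s1).
  by move: w2; rewrite -!ler_norml => w2; exact: le_trans w2 (ltW s1).
elim=> [|k IH] nu eta O v nub etab hv hO hv01.
  by exists 0 => w; rewrite !expr0 add0r; exact: hv01.
have /andP[nu0 nu1] := nub; have /andP[eta0 eta1] := etab.
have [m0 hm0] := step nu eta O v nub eta1 hv hO hv01.
have hv' := quad_solution_rescale m0 0 s0 b0 sp bal hv.
have [m' hm'] : exists m, forall w, box (0 : 'rV[R]_n) (sig ^+ k) (- b ^+ k)
    (b ^+ k) w -> m <= (v (rescale sig b 0 w) - m0) / s <= m + s ^+ k.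
  apply: (IH _ _ _ _ _ _ hv').
  - have bq : b / sig ^+ 2 <= 1 by rewrite ler_pdivrMr ?exprn_gt0// mul1r.
    have bq0 : 0 <= b / sig ^+ 2 by rewrite divr_ge0 ?sqr_ge0// ltW.
    by rewrite mulr_ge0//= (le_trans _ nu1)// ler_piMl.
  - have bq : b / s <= 1 by rewrite ler_pdivrMr// mul1r.
    have bq0 : 0 <= b / s by rewrite divr_ge0 ?ltW.
    by rewrite mulr_ge0//= (le_trans _ eta1)// ler_piMl.
  - by move=> w /sub/sub1; exact: hO.
  - move=> w /sub /hm0 /andP[h1 h2].
    rewrite divr_ge0 ?subr_ge0 ?(ltW sp)//= ler_pdivrMr// mul1r.
    by rewrite lerBlDl (le_trans h2)// lerD2l.
exists (m0 + s * m') => w; rewrite /box /= subr0 -ler_norml => -[w1 w2].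
have [] := (andP (hm' (sig^-1 *: w.1, b^-1 * w.2) _)).
  rewrite /box /= subr0 -ler_norml normrZ normrM.
  rewrite (gtr0_norm (_ : 0 < sig^-1)) ?invr_gt0//.
  rewrite (gtr0_norm (_ : 0 < b^-1)) ?invr_gt0//.
  by rewrite !ler_pdivrMl// -!exprS.
have -> : rescale sig b 0 (sig^-1 *: w.1, b^-1 * w.2) = w.
  rewrite rescale0 /= scalerA divff ?gt_eqF// scale1r mulVKf ?gt_eqF//.
  by case: (w).
rewrite ler_pdivlMr// ler_pdivrMr// lerBrDl lerBlDl.
rewrite mulrC => h1 h2; rewrite h1 /= (le_trans h2)//.
by rewrite exprS mulrDl addrA (mulrC m') (mulrC (s ^+ k)).
Qed.

Lemma powers_small (R : realType) (x e : R) : 0 <= x < 1 -> 0 < e ->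
  exists k, x ^+ k < e.
Proof.
move=> /andP[x0 x1] e0.
have xn : `|x| < 1 by rewrite ger0_norm.
have [k _ hk] := (cvgr_lt _ (cvg_expr xn) _ e0).
by exists k; apply: hk => /=.
Qed.

Lemma powR_exprn (R : realType) (x a : R) (k : nat) : 0 <= x ->
  (x `^ a) ^+ k = (x ^+ k) `^ a.
Proof.
move=> x0; rewrite -(powR_mulrn k x0) -(powR_mulrn k (powR_ge0 x a)).
by rewrite -!powRrM mulrC.
Qed.

(** Both the point and the origin lie in the last box of the sequence containing
    the point, while the point violates the size condition of the next box in
    space or in time. *)
Lemma hoelder_of_decay (R : realType) (n : nat) (sig b al bt : R)
    (v : 'rV[R]_n * R -> R) :
  0 < sig < 1 -> 0 < b < 1 -> 0 < al -> 0 < bt -> b `^ bt = sig `^ al ->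
  (forall k, exists m, forall w,
     box (0 : 'rV[R]_n) (sig ^+ k) (- b ^+ k) (b ^+ k) w ->
     m <= v w <= m + (sig `^ al) ^+ k) ->
  forall w, box (0 : 'rV[R]_n) 1 (- 1) 1 w ->
    `|v w - v 0| <= (sig `^ al)^-1 * (`|w.1| `^ al + `|w.2| `^ bt).
Proof.
move=> /andP[s0 s1] /andP[b0 b1] al0 bt0 bs decay w Bw.
set s := sig `^ al in bs decay *.
have sp : 0 < s by exact: powR_gt0.
have rhs0 : 0 <= `|w.1| `^ al + `|w.2| `^ bt by rewrite addr_ge0 ?powR_ge0.
pose inb k := (`|w.1| <= sig ^+ k) && (`|w.2| <= b ^+ k).
have [[k nk]|allk] := pselect (exists k, ~~ inb k); last first.
  have w0 : w = 0.
    have w10 : `|w.1| = 0.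
      apply/eqP; apply: contrapT => /negP wn.
      have wp : 0 < `|w.1| by rewrite lt_neqAle eq_sym wn normr_ge0.
      have [|k hk] := powers_small _ wp (x := sig); first by rewrite ltW.
      by apply: allk; exists k; rewrite /inb leNgt hk.
    have w20 : `|w.2| = 0.
      apply/eqP; apply: contrapT => /negP wn.
      have wp : 0 < `|w.2| by rewrite lt_neqAle eq_sym wn normr_ge0.
      have [|k hk] := powers_small _ wp (x := b); first by rewrite ltW.
      by apply: allk; exists k; rewrite /inb negb_and orbC -ltNge hk.
    move: w10 w20 => /normr0_eq0 w10 /normr0_eq0 w20.
    by case: (w) w10 w20 => x t /= -> ->.
  by rewrite {1}w0 subrr normr0 mulr_ge0// invr_ge0 ltW.
have exk : exists k, ~~ inb k by exists k.
have [k0 nk0 mink0] := ex_minnP exk.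
case: k0 nk0 mink0 => [|j] nj minj.
  by move: nj Bw; rewrite /inb /box /= !expr0 subr0 -ler_norml => /negP nj /andP.
have inj : inb j by apply: contraT => /minj; rewrite ltnn.
have [m hm] := decay j.
have osc : `|v w - v 0| <= s ^+ j.
  have /hm/andP[h1 h2] : box (0 : 'rV[R]_n) (sig ^+ j) (- b ^+ j) (b ^+ j) w.
    by move: inj => /andP[i1 i2]; split; rewrite ?subr0 -?ler_norml.
  have /hm/andP[h3 h4] : box (0 : 'rV[R]_n) (sig ^+ j) (- b ^+ j) (b ^+ j) 0.
    by split; rewrite /= ?subrr ?normr0 ?oppr_le0 !exprn_ge0// ltW.
  by rewrite ler_norml; apply/andP; split; lra.
apply: le_trans osc _; rewrite ler_pdivlMl// -exprS.
move: nj; rewrite negb_and -!ltNge => /orP[wj|wj].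
  apply: (@le_trans _ _ (`|w.1| `^ al)); last by rewrite lerDl powR_ge0.
  rewrite /s (powR_exprn _ _ (ltW s0)).
  by apply: (ge0_ler_powR (ltW al0));
    rewrite ?nnegrE ?normr_ge0 ?exprn_ge0 ?(ltW s0) ?(ltW wj).
apply: (@le_trans _ _ (`|w.2| `^ bt)); last by rewrite lerDr powR_ge0.
rewrite -bs (powR_exprn _ _ (ltW b0)).
by apply: (ge0_ler_powR (ltW bt0));
  rewrite ?nnegrE ?normr_ge0 ?exprn_ge0 ?(ltW b0) ?(ltW wj).
Qed.

(** * Local estimate and conclusion *)

Lemma stnorm_le (R : realType) (n : nat) (z : 'rV[R]_n * R) (l s : R) :
  `|z.1| <= l -> `|z.2| <= s -> stnorm z <= n%:R * l + s.
Proof.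
move=> zl zs; have l0 : 0 <= l by exact: le_trans zl.
have s0 : 0 <= s by exact: le_trans zs.
have nl : 0 <= n%:R * l by rewrite mulr_ge0.
rewrite /stnorm enormE sqr_sqrtr ?sqnorm_ge0//.
rewrite -[leRHS]ger0_norm ?addr_ge0// -sqrtr_sqr ler_sqrt ?sqr_ge0//.
have H1 : sqnorm z.1 <= (n%:R * l) ^+ 2.
  apply: le_trans (sqnorm_le zl) _; rewrite exprMn ler_wpM2r ?sqr_ge0//.
  by rewrite -natrX ler_nat; case: (n) => // k; rewrite expnS expn1 leq_pmulr.
have H2 : z.2 ^+ 2 <= s ^+ 2.
  by rewrite -[leLHS]real_normK ?num_real// ler_sqr ?nnegrE.
rewrite sqrrD; have : 0 <= n%:R * l * s *+ 2 by rewrite mulrn_wge0// mulr_ge0.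
by lra.
Qed.

Lemma enorm_ge (R : realType) (n : nat) (d : 'rV[R]_n) : `|d| <= enorm d.
Proof.
rewrite enormE -[leLHS]ger0_norm// -sqrtr_sqr ler_sqrt ?sqnorm_ge0//.
exact: sqnorm_ge.
Qed.

Lemma inner_set_box (R : realType) (n : nat) (O : set ('rV[R]_n * R))
    (rho l s : R) (z w : 'rV[R]_n * R) :
  inner_set O rho z -> n%:R * l + s <= rho ->
  `|w.1| <= l -> `|w.2| <= s -> O (z + w).
Proof.
move=> [Oz dz] ls wl ws; apply: contrapT => nO.
have : (dist_compl O z <= rho%:E)%E; last by rewrite leNgt dz.
apply: (@le_trans _ _ (stnorm (z - (z + w)))%:E).
  by apply: ereal_inf_lbound; exists (z + w).
rewrite lee_fin opprD addrA subrr sub0r; apply: le_trans ls.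
by apply: stnorm_le; rewrite /= normrN.
Qed.

(** The unit box is mapped to a box around [z1] whose size [lam] only depends on
    the data and on [rho]; [lam `^ (q - 2)] controls both the rescaled diffusion
    and the rescaled error. Points outside this box are far from [z1], and for them
    the bound on [u] suffices. *)
Lemma inner_hoelder (R : realType) (n : nat) (q delta : R) :
  2 < q -> 0 < delta -> (0 < n)%N ->
  exists al : R, 0 < al <= (q - 2) / (q - 1) /\
  forall eta M rho : R, 0 <= eta -> 0 <= M -> 0 < rho ->
  exists c : R, 0 < c /\
  forall (O : set ('rV[R]_n * R)) (u : 'rV[R]_n * R -> R),
    quad_solution q delta (delta ^+ 2) eta O u ->
    (forall z, O z -> `|u z| <= M) ->
    forall z1 z2, inner_set O rho z1 -> O z2 ->
      `|u z1 - u z2| <= c * (`|z1.1 - z2.1| `^ al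
                             + `|z1.2 - z2.2| `^ (al / rate_t q al)).
Proof.
move=> q2 d0 n0.
have [eps [sig [al [eps0 sigb alb decay]]]] := geometric_decay q2 d0 n0.
exists al; split=> // eta M rho eta0 M0 rho0.
have /andP[s0 s2] := sigb; have /andP[al0 al2] := alb.
have s1 : sig < 1 by clear -s2; lra.
have q1 : 0 < q - 1 by clear -q2; lra.
have be2 : 2 <= rate_t q al.
  have : al * (q - 1) <= q - 2 by rewrite -ler_pdivlMr.
  by move=> h; rewrite /rate_t; clear -h; lra.
have be0 : 0 < rate_t q al by apply: lt_le_trans be2.
set b := sig `^ rate_t q al in decay.
have b0 : 0 < b by exact: powR_gt0.
have b1 : b < 1.
  apply: le_lt_trans (s1); rewrite /b -[leRHS]powRr1 ?(ltW s0)//.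
  apply: ger_powR; first by rewrite s0 /= ltW.
  by apply: le_trans be2; rewrite ler1n.
set bt := al / rate_t q al.
have bt0 : 0 < bt by exact: divr_gt0.
have bbt : b `^ bt = sig `^ al.
  by rewrite /b -powRrM /bt mulrC divfK// gt_eqF.
set s := sig `^ al in bbt decay.
have sp : 0 < s by exact: powR_gt0.
(* Adding one keeps K at least one even when M vanishes. *)
pose K := 2 * M + 1.
have K1 : 1 <= K by rewrite /K; clear -M0; lra.
have K0 : 0 < K by apply: lt_le_trans K1.
have A0 : 0 < delta ^+ 2 + eta by rewrite ltr_wpDr// exprn_gt0.
have q20 : 0 < q - 2 by rewrite subr_gt0.
have [T1 T10 [T18 T1e]] := small_power A0 q20 eps0.
have n10 : 0 <= n%:R + 1 :> R by rewrite addr_ge0.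
have [l1 l10 [l12 l1rho]] := small_linear n10 rho0.
pose lam := Num.min (2 * T1) l1.
have lam0 : 0 < lam by rewrite lt_min l10 mulr_gt0.
have [lT ll] : lam <= 2 * T1 /\ lam <= l1.
  by rewrite /lam; split; rewrite !ge_min lexx ?orbT.
have lam1 : lam <= 1 by clear -lT T18; lra.
have lam_eps : (delta ^+ 2 + eta) * lam `^ (q - 2) <= eps.
  apply: le_trans T1e; rewrite ler_pM2l//; apply: (ge0_ler_powR (ltW q20)) => //.
    by rewrite nnegrE ltW.
  by rewrite nnegrE mulr_ge0// ltW.
have lam_rho : n%:R * lam + lam <= rho.
  apply: le_trans l1rho.
  by rewrite -[X in _ + X <= _]mul1r -mulrDl; apply: ler_wpM2l.
clearbody lam.
pose mu := K / (K / lam) `^ q.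
have KL0 : 0 < (K / lam) `^ q by rewrite powR_gt0// divr_gt0.
have mu0 : 0 < mu by exact: divr_gt0.
have balance : (K / lam) `^ q = K / mu.
  by rewrite /mu invf_div mulrCA divff ?mulr1// gt_eqF.
have muE : mu <= lam `^ (q - 2) * lam ^+ 2.
  have -> : lam `^ (q - 2) * lam ^+ 2 = lam `^ q.
    rewrite -powR_mulrn ?(ltW lam0)// -powRD ?subrK//.
    by rewrite (gt_eqF lam0) implybT.
  rewrite /mu (powRM _ (ltW K0)) ?invr_ge0 ?(ltW lam0)//.
  have -> : lam^-1 `^ q = (lam `^ q)^-1.
    by rewrite -(powR_inv1 (ltW lam0)) -powRrM mulN1r powRN.
  rewrite invfM invrK mulrA ler_piMl ?powR_ge0//.
  rewrite ler_pdivrMr ?powR_gt0// mul1r -[leLHS]powRr1 ?(ltW K0)//.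
  by apply: ler_powR => //; clear -q2; lra.
have lq1 : lam `^ (q - 2) <= 1.
  have := ge0_ler_powR (ltW q20) _ _ lam1; rewrite !nnegrE powR1.
  by apply; rewrite ?ler01// ltW.
have mu_lam : mu <= lam.
  apply: le_trans muE _; rewrite expr2 mulrA ler_piMl ?(ltW lam0)//.
  by rewrite mulr_ile1 ?powR_ge0// ltW.
have nu_eps : mu / lam ^+ 2 * delta ^+ 2 <= eps.
  apply: le_trans lam_eps; rewrite mulrC.
  have dle : delta ^+ 2 <= delta ^+ 2 + eta by rewrite lerDl.
  apply: ler_pM => //; first exact: sqr_ge0.
    by rewrite divr_ge0 ?sqr_ge0// ltW.
  by rewrite ler_pdivrMr ?exprn_gt0.
have eta_eps : mu / K * eta <= eps.
  apply: le_trans lam_eps; rewrite mulrC.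
  have dle : eta <= delta ^+ 2 + eta by rewrite lerDr sqr_ge0.
  apply: ler_pM => //; first by rewrite divr_ge0 ?ltW.
  rewrite ler_pdivrMr//; apply: le_trans muE _.
  apply: ler_wpM2l; first exact: powR_ge0.
  by apply: le_trans K1; rewrite expr_le1// ltW.
exists ((K / s + 2 * M) * (lam `^ (- al) + mu `^ (- bt))).
have P1 : 0 < lam `^ (- al) by exact: powR_gt0.
have P2 : 0 < mu `^ (- bt) by exact: powR_gt0.
have Ks : 0 < K / s by exact: divr_gt0.
split; first by rewrite mulr_gt0 ?(addr_gt0 P1 P2)// ltr_wpDr// mulr_ge0.
move=> O u hu uM z1 z2 Oz1 Oz2.
have scale (c r t : R) : 0 <= r -> 0 < t -> (r / t) `^ c = t `^ (- c) * r `^ c.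
  move=> r0 t0; rewrite powRM ?invr_ge0 ?(ltW t0)// mulrC; congr (_ * _).
  by rewrite -(powR_inv1 (ltW t0)) -powRrM mulN1r.
set X := `|_| `^ al; set Y := `|_| `^ bt.
have X0 : 0 <= X by exact: powR_ge0.
have Y0 : 0 <= Y by exact: powR_ge0.
have bound (Z : R) : Z <= lam `^ (- al) * X + mu `^ (- bt) * Y ->
    forall k, 0 <= k <= K / s + 2 * M ->
    k * Z <= (K / s + 2 * M) * (lam `^ (- al) + mu `^ (- bt)) * (X + Y).
  move=> ZXY k /andP[k0 kK]; rewrite -mulrA.
  have W0 : 0 <= lam `^ (- al) * X + mu `^ (- bt) * Y.
    by rewrite addr_ge0// mulr_ge0// ltW.
  apply: (@le_trans _ _ (k * (lam `^ (- al) * X + mu `^ (- bt) * Y))).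
    exact: ler_wpM2l.
  apply: ler_pM => //; rewrite mulrDr !mulrDl.
  have H1 : 0 <= mu `^ (- bt) * X by rewrite mulr_ge0// ltW.
  have H2 : 0 <= lam `^ (- al) * Y by rewrite mulr_ge0// ltW.
  by move: H1 H2; clear; lra.
have uO z : O z -> - M <= u z <= M by move=> /uM; rewrite ler_norml.
have M2 : `|u z1 - u z2| <= 2 * M.
  have /andP[h1 h2] := uO _ Oz1.1; have /andP[h3 h4] := uO _ Oz2.
  by rewrite ler_norml; clear -h1 h2 h3 h4; apply/andP; split; lra.
have far (r t c : R) : 0 < c -> 0 < t -> t < r -> 1 <= t `^ (- c) * r `^ c.
  move=> c0 t0 tr; rewrite -scale ?(ltW (lt_trans t0 tr))//.
  have h : 1 <= r / t by rewrite ler_pdivlMr// mul1r ltW.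
  have := ge0_ler_powR (ltW c0) _ _ h; rewrite !nnegrE powR1.
  by apply; rewrite ?ler01// (le_trans _ h).
have k2M : 0 <= 2 * M <= K / s + 2 * M by rewrite mulr_ge0//= lerDr ltW.
have [xf|xn] := ltP lam `|z1.1 - z2.1|.
  rewrite -[leLHS]mulr1; apply: (@le_trans _ _ (2 * M * 1)); first by rewrite ler_wpM2r.
  apply: bound => //; apply: le_trans (far _ _ _ al0 lam0 xf) _.
  by rewrite lerDl mulr_ge0// ltW.
have [tf|tn] := ltP mu `|z1.2 - z2.2|.
  rewrite -[leLHS]mulr1; apply: (@le_trans _ _ (2 * M * 1)); first by rewrite ler_wpM2r.
  apply: bound => //; apply: le_trans (far _ _ _ bt0 mu0 tf) _.
  by rewrite lerDr mulr_ge0// ltW.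
have hv := quad_solution_rescale (- M) z1 lam0 mu0 K0 balance hu.
have inO w : box (0 : 'rV[R]_n) 1 (- 1) 1 w -> O (rescale lam mu z1 w).
  rewrite /box /= subr0 -ler_norml => -[w1 w2].
  have -> : rescale lam mu z1 w = z1 + (lam *: w.1, mu * w.2) by case: (z1).
  apply: (inner_set_box Oz1 lam_rho) => /=.
    by rewrite normrZ (gtr0_norm lam0) ler_piMr// ltW.
  rewrite normrM (gtr0_norm mu0); apply: le_trans mu_lam.
  by rewrite ler_piMr// ltW.
pose w : 'rV[R]_n * R := (lam^-1 *: (z2.1 - z1.1), mu^-1 * (z2.2 - z1.2)).
have w1E : `|w.1| = `|z1.1 - z2.1| / lam.
  by rewrite /= normrZ gtr0_norm ?invr_gt0// distrC mulrC.
have w2E : `|w.2| = `|z1.2 - z2.2| / mu.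
  by rewrite /= normrM gtr0_norm ?invr_gt0// distrC mulrC.
have wz : rescale lam mu z1 w = z2.
  rewrite /rescale /= scalerA divff ?gt_eqF// scale1r mulVKf ?gt_eqF//.
  by rewrite [z1.1 + _]addrC subrK [z1.2 + _]addrC subrK; case: (z2).
have z0 : rescale lam mu z1 0 = z1.
  by rewrite /rescale /= scaler0 mulr0 !addr0; case: (z1).
have Bw : box (0 : 'rV[R]_n) 1 (- 1) 1 w.
  by rewrite /box /= -ler_norml subr0 -/w.1 -/w.2 w1E w2E !ler_pdivrMr// !mul1r.
(* Shifting by M and dividing by K brings the values between zero and one. *)
pose v z := (u (rescale lam mu z1 z) - - M) / K.
have hv01 z : box (0 : 'rV[R]_n) 1 (- 1) 1 z -> 0 <= v z <= 1.
  move=> /inO /uO /andP[h1 h2]; rewrite /v divr_ge0 ?(ltW K0)//=; last first.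
    by rewrite opprK -lerBlDr sub0r.
  by rewrite ler_pdivrMr// mul1r /K; clear -h2; lra.
have nub : 0 <= mu / lam ^+ 2 * delta ^+ 2 <= eps.
  by rewrite nu_eps andbT mulr_ge0 ?sqr_ge0// divr_ge0 ?sqr_ge0// ltW.
have etab : 0 <= mu / K * eta <= eps.
  by rewrite eta_eps andbT mulr_ge0// divr_ge0 ?ltW.
have hdec k := decay k _ _ _ v nub etab hv inO hv01.
have s01 : 0 < sig < 1 by rewrite s0.
have b01 : 0 < b < 1 by rewrite b0.
have := hoelder_of_decay s01 b01 al0 bt0 bbt hdec Bw.
rewrite w1E w2E (scale al)// (scale bt)// -/X -/Y => hvw.
have -> : u z1 - u z2 = - (K * (v w - v 0)).
  rewrite /v wz z0; field; by rewrite gt_eqF.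
rewrite normrN normrM (gtr0_norm K0).
apply: (@le_trans _ _ (K / s * (s * `|v w - v 0|))).
  by rewrite mulrA divfK// gt_eqF.
apply: bound; first by rewrite -ler_pdivlMl.
by rewrite ltW//= lerDl mulr_ge0.
Qed.

Theorem theorem6p7 (R : realType) (N : nat) (q delta eta_m eta_p M p : R)
    (hN : (1 <= N)%N) (hq : 2 < q) (hdelta : 1 < delta)
    (heta_m : 0 <= eta_m) (heta_p : 0 <= eta_p) (hM : 0 <= M)
    (hp : p^-1 + q^-1 = 1) :
  exists theta : R, p < theta /\
  exists C : R -> R, (forall rho : R, 0 < rho -> 0 < C rho) /\
  forall (D : nat) (O : set ('rV[R]_N * R))
    (H : 'rV[R]_N * R -> 'rV[R]_N -> R)
    (sigma : 'rV[R]_N * R -> 'M[R]_(N, D)) (u : 'rV[R]_N * R -> R),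
  (1 <= D)%N ->
  O !=set0 -> open O ->
  {within O `*` [set: 'rV[R]_N], continuous (fun w => H w.1 w.2)} ->
  (forall (y : 'rV[R]_N * R) (z : 'rV[R]_N), O y ->
     delta^-1 * enorm z `^ q - eta_m <= H y z <= delta * enorm z `^ q + eta_p) ->
  locally_lipschitz_on O sigma ->
  (forall y, O y -> frobenius (sigma y) <= delta) ->
  continuous_viscosity_solution O (fun y => sigma y *m (sigma y)^T) H u ->
  (forall y, O y -> `|u y| <= M) ->
  forall rho : R, 0 < rho ->
  forall (x1 x2 : 'rV[R]_N) (t1 t2 : R),
    inner_set O rho (x1, t1) -> inner_set O rho (x2, t2) ->
    `|u (x1, t1) - u (x2, t2)| <=
      C rho * (enorm (x1 - x2) `^ ((theta - p) / (theta - 1))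
               + `|t1 - t2| `^ ((theta - p) / theta)).
Proof.
have d0 : 0 < delta by apply: lt_trans hdelta.
have q1 : 0 < q - 1 by lra.
have q0 : 0 < q by lra.
have pE : p = q / (q - 1).
  have pV : p^-1 = (q - 1) / q.
    by rewrite mulrBl mul1r divff ?gt_eqF// -hp addrK.
  by rewrite -[LHS]invrK pV invf_div.
have [al [/andP[al0 al2] est]] := inner_hoelder hq d0 hN.
have al1 : al < 1.
  by apply: le_lt_trans al2 _; rewrite ltr_pdivrMr//; lra.
have al2' : al * (q - 1) <= q - 2 by rewrite -ler_pdivlMr.
have be0 : rate_t q al != 0 by rewrite gt_eqF// /rate_t; lra.
have alN : 1 - al != 0 by rewrite gt_eqF// subr_gt0.
have qN : q - 1 != 0 by rewrite gt_eqF.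
(* Solving (theta - p) / (theta - 1) = al for theta; the time exponent then
   agrees with the parabolic scaling. *)
pose theta := (p - al) / (1 - al).
have tp : theta - p = al * (p - 1) / (1 - al) by rewrite /theta; field.
have t1 : theta - 1 = (p - 1) / (1 - al) by rewrite /theta; field.
have p1E : p - 1 = (q - 1)^-1 by rewrite pE; field.
have p1 : 0 < p - 1 by rewrite p1E invr_gt0.
have ex : (theta - p) / (theta - 1) = al.
  by rewrite tp t1; field; rewrite alN gt_eqF.
have palE : p - al = rate_t q al / (q - 1) by rewrite pE /rate_t; field.
have et : (theta - p) / theta = al / rate_t q al.
  by rewrite tp p1E /theta palE; field; rewrite alN qN be0.
exists theta; split.
  by rewrite -subr_gt0 tp divr_gt0 ?subr_gt0// mulr_gt0.
rewrite ex et.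
pose eta := Num.max eta_m eta_p.
have [em ep] : eta_m <= eta /\ eta_p <= eta.
  by rewrite /eta; split; rewrite le_max lexx ?orbT.
have eta0 : 0 <= eta by apply: le_trans em.
have : forall rho : R, exists c : R, 0 < rho -> 0 < c /\
  forall (O : set ('rV[R]_N * R)) (u : 'rV[R]_N * R -> R),
    quad_solution q delta (delta ^+ 2) eta O u ->
    (forall z, O z -> `|u z| <= M) ->
    forall z1 z2, inner_set O rho z1 -> O z2 ->
      `|u z1 - u z2| <= c * (`|z1.1 - z2.1| `^ al
                             + `|z1.2 - z2.2| `^ (al / rate_t q al)).
  move=> rho; have [rho0|] := pselect (0 < rho); last by exists 0.
  by have [c hc] := est _ _ _ eta0 hM rho0; exists c.
move=> /choice[C hC]; exists C; split; first by move=> rho /hC[].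
move=> D O H sigma u _ _ oO _ hH _ hs hu uM rho rho0 x1 x2 s1 s2 hO1 [hO2 _].
have [C0 hest] := hC rho rho0.
have hq' := viscosity_quad_solution d0 em ep oO hH hs hu.
apply: le_trans (hest O u hq' uM (x1, s1) (x2, s2) hO1 hO2) _.
rewrite ler_pM2l// lerD2r; apply: (ge0_ler_powR (ltW al0)).
- by rewrite nnegrE.
- by rewrite nnegrE sqrtr_ge0.
- exact: enorm_ge.
Qed.
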